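(* Let $\varepsilon_1,\varepsilon_2,\dots$ be independent with $\varepsilon_i\sim N(0,\sigma_1^2)$ and let $M<\infty$ be such that $\int_0^1|X_i(t)|\,dt\le M$ for all $i$. Suppose that the following hold. (A-1) There exists $S<\infty$ such that $S_p\le S$ for all $p$. (A-2) There exists $m>0$ such that $p^m\omega_p$ is bounded, that is, $\omega_p\le H/p^m$ for some $H<\infty$. (A-3) For a given $t\in[0,1]$ there exists $b_t$ such that $p^{-b_t}\alpha_{n,p}(t)$ is bounded for all $n$ and $p$. (A-4) There exists $c$ such that $p^{-c}\sup_t\alpha_{n,p}(t)$ is bounded for all $n$ and $p$. (A-5) There exists a $p^*$ such that $\delta^{V_{n,p^*}}_{2S}+\theta^{V_{n,p^*}}_{S,2S}$ is bounded away from one (from below one) for large enough $n$. Fix $p=p^*$. For $\phi\ge0$ let $\widehat\beta_n$ be the FLiRTI estimate based on $n$ observations, computed (with the Dantzig selector or the lasso) with $p=p^*$ and $\lambda=\sigma_1\sqrt{2(1+\phi)\log p}+M\omega_p\sqrt n$. Suppose also that the sparsity condition that $\boldsymbol\gamma_p=A\boldsymbol\eta_p$ has at most $S_p$ non-zero components and the condition $\delta^{V_{n,p}}_{2S_p}+\theta^{V_{n,p}}_{S_p,2S_p}<1$ hold, and, if the lasso is used, that $\mathbf{u}=(D_\lambda\tilde V^T\tilde VD_\lambda)^{-1}\mathbf{1}\ge\mathbf{0}$ and $\|\tilde V^T\tilde VD_\lambda\mathbf{u}\|_\infty\le1$ (with $V=V_{n,p}$). Let $$E_n(t)=\frac{H}{p^{*m}}\left\{1+C_{n,p^*}(t)M\sqrt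 S\right\}.$$ Then, with arbitrarily high probability, as $n\to\infty$, $$|\widehat\beta_n(t)-\beta(t)|\le O(n^{-1/2})+E_n(t)\qquad\text{and}\qquad\sup_t|\widehat\beta_n(t)-\beta(t)|\le O(n^{-1/2})+\sup_tE_n(t).$$ Here ''with arbitrarily high probability'' means that the probability converges to one as $\phi\to\infty$: for every $\rho>0$ there is $\phi_0$ such that for each $\phi\ge\phi_0$ there are $K<\infty$ and $N$ such that, for all $n\ge N$, with probability at least $1-\rho$ each of the two inequalities holds with $O(n^{-1/2})$ replaced by $Kn^{-1/2}$.
   Context: Model: for each $n$, $Y_i=\int_0^1X_i(t)\beta(t)\,dt+\varepsilon_i$, $i=1,\dots,n$ (the intercept is taken to be $0$), where $X_i:[0,1]\to\mathbb{R}$ are functional predictors, $\beta:[0,1]\to\mathbb{R}$ is the fixed coefficient function and $\varepsilon_i$ are random errors. Distributional statements are conditional on the $X_i$ (which may be treated as fixed). For each $p$, $\mathbf{B}_p(t)=(b_1(t),\dots,b_p(t))^T$ is a given $p$-dimensional basis on $[0,1]$, $\boldsymbol{\eta}_p\in\mathbb{R}^p$, $e_p(t)=\beta(t)-\mathbf{B}_p(t)^T\boldsymbol{\eta}_p$, $\omega_p=\sup_{0\le t\le1}|e_p(t)|$, $A$ (depending on $p$) is an invertible $p\times p$ matrix, $\boldsymbol{\gamma}_p=A\boldsymbol{\eta}_p$, and $S_p$ bounds the number of non-zero components of $\boldsymbol\gamma_p$. All integrals are assumed to exist; $t$ ranges over $[0,1]$ in suprema. Put $\mathbf{X}_i=\int_0^1X_i(t)\mathbf{B}_p(t)\,dt\in\mathbb{R}^p$,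 let $X$ be the $n\times p$ matrix with rows $\mathbf{X}_i^T$, let $V=V_{n,p}=XA^{-1}$, and let $\varepsilon_i^*=\varepsilon_i+\int_0^1X_i(t)e_p(t)\,dt$, so that $\mathbf{Y}=V\boldsymbol{\gamma}_p+\boldsymbol{\varepsilon}^*$. The columns of $V$ are assumed non-zero; $\tilde V$ is $V$ with each column divided by its Euclidean norm, and $\tilde V_j$ is its $j$th column. FLiRTI estimate with tuning parameter $\lambda$: let $\widehat{\tilde{\boldsymbol\gamma}}$ be either a lasso solution, minimizing $\frac12\|\mathbf{Y}-\tilde V\mathbf{g}\|_2^2+\lambda\|\mathbf{g}\|_1$ over $\mathbf{g}\in\mathbb{R}^p$, or a Dantzig selector solution, minimizing $\|\mathbf{g}\|_1$ subject to $|\tilde V_j^T(\mathbf{Y}-\tilde V\mathbf{g})|\le\lambda$ for $j=1,\dots,p$. Then $\widehat{\boldsymbol\gamma}$ is obtained by dividing the $j$th component of $\widehat{\tilde{\boldsymbol\gamma}}$ by the Euclidean norm of the $j$th column of $V$, and $\widehat\beta(t)=\mathbf{B}_p(t)^TA^{-1}\widehat{\boldsymbol\gamma}$. $D_\lambda$ is the diagonal matrix with $j$th diagonal entry $1,-1$ or $0$ according to whether the $j$th component of the lasso solution with tuning parameter $\lambda$ is positive, negative or zero; $\mathbf{1}$ is a vector of ones; vector inequalities are componentwise; the inverse of $D_\lambda\tilde V^T\tilde VD_\lambda$ is understood on the coordinates where the diagonal of $D_\lambda$ is non-zero. For an $n\times p$ matrix $Z$ and $T\subset\{1,\dots,p\}$,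 $Z_T$ is the $n\times|T|$ matrix obtained by standardizing the columns of $Z$ to Euclidean norm one and extracting those with indices in $T$. $\delta^Z_S$ is the smallest quantity such that $(1-\delta_S^Z)\|\mathbf{c}\|_2^2\le\|Z_T\mathbf{c}\|_2^2\le(1+\delta_S^Z)\|\mathbf{c}\|_2^2$ for all $T$ with $|T|\le S$ and all $\mathbf{c}\in\mathbb{R}^{|T|}$. For $S+S'\le p$, $\theta^Z_{S,S'}$ is the smallest quantity such that $|(Z_T\mathbf{c})^TZ_{T'}\mathbf{c}'|\le\theta^Z_{S,S'}\|\mathbf{c}\|_2\|\mathbf{c}'\|_2$ for all disjoint $T,T'$ with $|T|\le S$, $|T'|\le S'$ and all vectors $\mathbf{c},\mathbf{c}'$ of corresponding lengths. Finally, $$C_{n,p}(t)=\frac{4\alpha_{n,p}(t)}{1-\delta^{V}_{2S_p}-\theta^{V}_{S_p,2S_p}},\qquad \alpha_{n,p}(t)=\sqrt{\sum_{j=1}^p\frac{(\mathbf{B}_p(t)^TA_j^{-1})^2}{\frac1n\sum_{i=1}^n\left(\int_0^1X_i(s)\mathbf{B}_p(s)^TA_j^{-1}\,ds\right)^2}},$$ where $A_j^{-1}$ is the $j$th column of $A^{-1}$. *)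

(* Defs.v *)
From HB Require Import structures.
From mathcomp Require Import all_boot all_order all_algebra.
From mathcomp Require Import all_classical all_reals all_analysis.

Set Implicit Arguments.
Unset Strict Implicit.
Unset Printing Implicit Defensive.

Import Order.TTheory GRing.Theory Num.Theory.
Import numFieldNormedType.Exports.

Local Open Scope classical_set_scope.
Local Open Scope ring_scope.

Definition norm1 (R : realType) (n : nat) (x : 'cV[R]_n) : R :=
  \sum_(i < n) `|x i 0|.

Definition norm2 (R : realType) (n : nat) (x : 'cV[R]_n) : R :=
  Num.sqrt (\sum_(i < n) x i 0 ^+ 2).

Definition int01 (R : realType) (f : R -> R) : R :=
  Rintegral (@lebesgue_measure R) `[0%R, 1%R] f.

Definition integrable01 (R : realType) (f : R -> R) : Prop :=
  (@lebesgue_measure R).-integrable `[0%R, 1%R] (EFin \o f).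

(* Extended-real valued, so that the supremum of an unbounded function is
   +oo (the real-valued [sup] would return 0). *)
Definition sup01 (R : realType) (f : R -> R) : \bar R :=
  ereal_sup [set (f t)%:E | t in `[0%R, 1%R]].

Definition lin_indep01 (R : realType) (p : nat) (B : R -> 'cV[R]_p) : Prop :=
  forall c : 'rV[R]_p,
    (forall t : R, 0 <= t <= 1 -> (c *m B t) 0 0 = 0) -> c = 0.

(* The mutual independence of a sequence is the product rule over all of its
   finite subfamilies. *)
Definition mutually_independent (R : realType) (d : measure_display)
    (Omega : measurableType d) (P : probability Omega R)
    (eps : nat -> {RV P >-> R}) : Prop :=
  forall (s : seq nat) (U : nat -> set R), uniq s ->
    (forall i, measurable (U i)) ->
    P [set w | forall i, i \in s -> U i (eps i w)] =
    (\prod_(i <- s) P (eps i @^-1` U i))%E.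

(* The estimator is an arbitrary, possibly non-measurable, choice of a
   solution of an optimization problem, so "E has probability at least q" is
   stated through a measurable event contained in E. *)
Definition with_prob_ge (R : realType) (d : measure_display)
    (Omega : measurableType d) (P : probability Omega R) (q : R)
    (E : set Omega) : Prop :=
  exists F : set Omega, [/\ measurable F, F `<=` E & (q%:E <= P F)%E].

Definition standardize (R : realType) (n p : nat) (Z : 'M[R]_(n, p)) :
    'M[R]_(n, p) :=
  \matrix_(i < n, j < p) (Z i j / norm2 (col j Z)).

Definition std_cols (R : realType) (n p : nat) (Z : 'M[R]_(n, p))
    (T : {set 'I_p}) : 'M[R]_(n, #|T|) :=
  colsub (@enum_val _ (mem T)) (standardize Z).

(* The smallest delta is the infimum of the admissible ones: they form a
   closed nonempty set. The constraint 0 <= delta is automatic unless no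
   nonzero vector c is tested (S = 0 or p = 0), in which case delta = 0. *)
Definition restricted_isometry (R : realType) (n p : nat) (Z : 'M[R]_(n, p))
    (S : nat) : R :=
  inf [set delta : R | 0 <= delta /\
    forall T : {set 'I_p}, (#|T| <= S)%N -> forall c : 'cV[R]_#|T|,
      (1 - delta) * norm2 c ^+ 2 <= norm2 (std_cols Z T *m c) ^+ 2
        <= (1 + delta) * norm2 c ^+ 2].

(* Same remark on 0 <= theta. The definition also makes sense when
   p < S + S', since only the sizes of the disjoint sets T and T' matter. *)
Definition restricted_orthogonality (R : realType) (n p : nat)
    (Z : 'M[R]_(n, p)) (S S' : nat) : R :=
  inf [set theta : R | 0 <= theta /\
    forall T T' : {set 'I_p}, (#|T| <= S)%N -> (#|T'| <= S')%N ->
      [disjoint T & T']%B -> forall (c : 'cV[R]_#|T|) (c' : 'cV[R]_#|T'|),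
      `|((std_cols Z T *m c)^T *m (std_cols Z T' *m c')) 0 0|
        <= theta * norm2 c * norm2 c'].

Definition is_lasso (R : realType) (n p : nat) (Z : 'M[R]_(n, p))
    (y : 'cV[R]_n) (lambda : R) (g : 'cV[R]_p) : Prop :=
  forall h : 'cV[R]_p,
    2^-1 * norm2 (y - Z *m g) ^+ 2 + lambda * norm1 g <=
    2^-1 * norm2 (y - Z *m h) ^+ 2 + lambda * norm1 h.

Definition dantzig_feasible (R : realType) (n p : nat) (Z : 'M[R]_(n, p))
    (y : 'cV[R]_n) (lambda : R) (g : 'cV[R]_p) : Prop :=
  forall j : 'I_p, `|((col j Z)^T *m (y - Z *m g)) 0 0| <= lambda.

Definition is_dantzig (R : realType) (n p : nat) (Z : 'M[R]_(n, p))
    (y : 'cV[R]_n) (lambda : R) (g : 'cV[R]_p) : Prop :=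
  dantzig_feasible Z y lambda g /\
  forall h : 'cV[R]_p, dantzig_feasible Z y lambda h -> norm1 g <= norm1 h.

Inductive flirti_method := Lasso | Dantzig.

Definition is_solution (meth : flirti_method) (R : realType) (n p : nat)
    (Z : 'M[R]_(n, p)) (y : 'cV[R]_n) (lambda : R) (g : 'cV[R]_p) : Prop :=
  match meth with
  | Lasso => is_lasso Z y lambda g
  | Dantzig => is_dantzig Z y lambda g
  end.

Definition sign_diag (R : realType) (p : nat) (g : 'cV[R]_p) : 'M[R]_p :=
  diag_mx (\row_(j < p) Num.sg (g j 0)).

Definition supp (R : realType) (p : nat) (g : 'cV[R]_p) : {set 'I_p} :=
  [set j | g j 0 != 0]%SET.

Definition supp_block (R : realType) (n p : nat) (Z : 'M[R]_(n, p))
    (g : 'cV[R]_p) : 'M[R]_#|supp g| :=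
  mxsub (@enum_val _ (mem (supp g))) (@enum_val _ (mem (supp g)))
    (sign_diag g *m Z^T *m Z *m sign_diag g).

(* [rowsub enum_val 1] selects the coordinates in the support, so its
   transpose extends a vector by zero outside of the support. *)
Definition dual_vec (R : realType) (n p : nat) (Z : 'M[R]_(n, p))
    (g : 'cV[R]_p) : 'cV[R]_p :=
  (rowsub (@enum_val _ (mem (supp g))) (1%:M : 'M[R]_p))^T
    *m (invmx (supp_block Z g) *m const_mx 1).

(* [invmx] is the identity on singular matrices, hence the explicit
   invertibility requirement. *)
Definition lasso_condition (R : realType) (n p : nat) (Z : 'M[R]_(n, p))
    (g : 'cV[R]_p) : Prop :=
  [/\ supp_block Z g \in unitmx,
      forall j, 0 <= dual_vec Z g j 0
    & forall j, `|(Z^T *m Z *m sign_diag g *m dual_vec Z g) j 0| <= 1].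

Definition responses (R : realType) (X : nat -> R -> R) (beta : R -> R)
    (n : nat) (e : nat -> R) : 'cV[R]_n :=
  \col_(i < n) (int01 (fun t => X i t * beta t) + e i).

Definition scores (R : realType) (X : nat -> R -> R) (n p : nat)
    (B : R -> 'cV[R]_p) : 'M[R]_(n, p) :=
  \matrix_(i < n, j < p) int01 (fun t => X i t * B t j 0).

Definition Vmat (R : realType) (X : nat -> R -> R) (n p : nat)
    (B : R -> 'cV[R]_p) (A : 'M[R]_p) : 'M[R]_(n, p) :=
  scores X n B *m invmx A.

Definition approx_err (R : realType) (beta : R -> R) (p : nat)
    (B : R -> 'cV[R]_p) (eta : 'cV[R]_p) (t : R) : R :=
  beta t - ((B t)^T *m eta) 0 0.

Definition omega (R : realType) (beta : R -> R) (p : nat)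
    (B : R -> 'cV[R]_p) (eta : 'cV[R]_p) : \bar R :=
  sup01 (fun t => `|approx_err beta B eta t|).

Definition basis_Ainv (R : realType) (p : nat) (B : R -> 'cV[R]_p)
    (A : 'M[R]_p) (j : 'I_p) (t : R) : R :=
  ((B t)^T *m col j (invmx A)) 0 0.

Definition alpha (R : realType) (X : nat -> R -> R) (n p : nat)
    (B : R -> 'cV[R]_p) (A : 'M[R]_p) (t : R) : R :=
  Num.sqrt (\sum_(j < p) (basis_Ainv B A j t ^+ 2 /
    (n%:R^-1 * \sum_(i < n) int01 (fun s => X i s * basis_Ainv B A j s) ^+ 2))).

Definition Cnp (R : realType) (X : nat -> R -> R) (n p : nat)
    (B : R -> 'cV[R]_p) (A : 'M[R]_p) (Sp : nat) (t : R) : R :=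
  4 * alpha X n B A t /
  (1 - restricted_isometry (Vmat X n B A) (2 * Sp)
     - restricted_orthogonality (Vmat X n B A) Sp (2 * Sp)).

Definition tuning (R : realType) (sigma1 phi M : R) (p n : nat) (om : R) : R :=
  sigma1 * Num.sqrt (2 * (1 + phi) * ln p%:R) + M * om * Num.sqrt n%:R.

Definition unstandardize (R : realType) (n p : nat) (V : 'M[R]_(n, p))
    (g : 'cV[R]_p) : 'cV[R]_p :=
  \col_(j < p) (g j 0 / norm2 (col j V)).

Definition beta_hat (R : realType) (p : nat) (B : R -> 'cV[R]_p)
    (A : 'M[R]_p) (n : nat) (V : 'M[R]_(n, p)) (g : 'cV[R]_p) (t : R) : R :=
  ((B t)^T *m invmx A *m unstandardize V g) 0 0.

Definition E_bound (R : realType) (X : nat -> R -> R) (H m M : R)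
    (S Sp n p : nat) (B : R -> 'cV[R]_p) (A : 'M[R]_p) (t : R) : R :=
  H / p%:R `^ m * (1 + Cnp X n B A Sp t * M * Num.sqrt S%:R).

(* Main.v *)
Require Import Defs.
From HB Require Import structures.
From mathcomp Require Import all_boot all_order all_algebra.
From mathcomp Require Import all_classical all_reals all_analysis.
From mathcomp Require Import measurable_realfun ring lra.

Set Implicit Arguments.
Unset Strict Implicit.
Unset Printing Implicit Defensive.

Import Order.TTheory GRing.Theory Num.Theory.
Import numFieldNormedType.Exports.

Local Open Scope classical_set_scope.
Local Open Scope ring_scope.

(** The number of coefficients is fixed, so only the sample size grows, and the
    proof separates a deterministic recovery bound from a probability estimate.

    Recovery ([dantzig_error]).  Let [g] solve the Dantzig selector problem and
    let [gamma] be a feasible vector with at most [S] non-zero entries.  Since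
    [g] has the smaller l1 norm, the part of [h = g - gamma] outside the support
    of [gamma] is dominated in l1 norm by the part on the support, and
    feasibility of both vectors makes the correlations of [W h] with the columns
    of the design [W] at most [2 lambda].  Cutting the complement of the support
    into blocks of [S] entries of decreasing size ([shelling_tail]), the
    restricted isometry and orthogonality constants give
    [norm2 h <= 4 lambda sqrt S / (1 - delta - theta)].  Under the condition
    imposed on the lasso, the vector [D u] is a dual certificate, so the lasso
    solution solves the Dantzig selector problem too ([lasso_is_dantzig]).

    Probability ([noise_event]).  The correlations of the noise with the [p]
    standardized columns have a common second moment, which depends neither on
    the sample size nor on the design: the errors are centered, square
    integrable and pairwise uncorrelated.  Markov's inequality for the sum of
    their squares bounds all of them by
    [sigma1 sqrt (2 (1 + phi) ln p)] with probability close to one when [p > 1]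
    and [phi] is large.  No finer Gaussian tail bound is needed, as [p] is fixed.

    Since the approximation error changes each response by at most [M omega],
    its correlation with a unit column is at most [M omega sqrt n]
    ([model_bias_le]).  Hence the standardized true coefficients are feasible,
    and the Cauchy-Schwarz inequality turns the recovery bound into a bound of
    the error at each point of the unit interval by [alpha / sqrt n] times the
    error of the coefficients, plus [omega] ([estimation_error]).
    The noise part of the tuning parameter contributes the [n^(-1/2)] term,
    uniformly in the point because [alpha] is bounded and the constants for [S]
    dominate those for [Sp p]; the remaining part contributes [E_bound].

    For [p = 1] the noise part of the tuning parameter is [0], since [ln 1 = 0],
    so the true coefficient need not be feasible; adding to it the projection of
    the noise restores feasibility, at the price of a term that is bounded in
    probability ([one_regressor_error]). *)

(** * Largest entries and the shelling argument *)

Section sums.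
Variables (R : realType) (I : finType).
Implicit Types (a b : I -> R) (T : {set I}).

Lemma sum_cauchy_schwarz (Q : pred I) a b :
  \sum_(i | Q i) a i * b i <=
  Num.sqrt (\sum_(i | Q i) a i ^+ 2) * Num.sqrt (\sum_(i | Q i) b i ^+ 2).
Proof.
set s := Num.sqrt _; set r := Num.sqrt (\sum_(i | Q i) b i ^+ 2).
have sge0 c : 0 <= \sum_(i | Q i) c i ^+ 2 :> R.
  by apply: sumr_ge0 => i _; exact: sqr_ge0.
have s2 : s ^+ 2 = \sum_(i | Q i) a i ^+ 2 by rewrite sqr_sqrtr.
have r2 : r ^+ 2 = \sum_(i | Q i) b i ^+ 2 by rewrite sqr_sqrtr.
have zero c : \sum_(i | Q i) c i ^+ 2 = 0 :> R -> forall i, Q i -> c i = 0.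
  move=> /eqP; rewrite psumr_eq0 => [/allP h i Qi|i _]; last exact: sqr_ge0.
  by have := h i (mem_index_enum i); rewrite Qi/= sqrf_eq0 => /eqP.
have [s0|s0] := eqVneq s 0.
  rewrite big1 ?mulr_ge0 ?sqrtr_ge0// => i Qi.
  by rewrite (zero a _ _ Qi) ?mul0r// -s2 s0 expr0n.
have [r0|r0] := eqVneq r 0.
  rewrite big1 ?mulr_ge0 ?sqrtr_ge0// => i Qi.
  by rewrite (zero b _ _ Qi) ?mulr0// -r2 r0 expr0n.
have sgt0 : 0 < s by rewrite lt_def s0 sqrtr_ge0.
have rgt0 : 0 < r by rewrite lt_def r0 sqrtr_ge0.
have := sge0 (fun i => r * a i - s * b i).
have -> : \sum_(i | Q i) (r * a i - s * b i) ^+ 2 =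
    r ^+ 2 * \sum_(i | Q i) a i ^+ 2 + s ^+ 2 * \sum_(i | Q i) b i ^+ 2
    - 2 * (s * r) * \sum_(i | Q i) a i * b i.
  rewrite !mulr_sumr -big_split -sumrB/=.
  by apply: eq_bigr => i _; ring.
rewrite -s2 -r2 => h.
rewrite -(ler_pM2l (mulr_gt0 sgt0 rgt0)); nra.
Qed.

Lemma sum_le_sqrt_card T a :
  \sum_(i in T) a i <= Num.sqrt #|T|%:R * Num.sqrt (\sum_(i in T) a i ^+ 2).
Proof.
have := sum_cauchy_schwarz (mem T) (fun=> 1) a.
under eq_bigr do rewrite mul1r.
under [X in Num.sqrt X]eq_bigr do rewrite expr1n.
by rewrite sumr_const.
Qed.

(** A set of [k] elements carrying the largest values of [a] on [U]. *)
Lemma largest_subset (a : I -> R) (U : {set I}) (k : nat) : (k <= #|U|)%N ->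
  exists2 T : {set I}, T \subset U /\ #|T| = k &
    forall i j, i \in T -> j \in U :\: T -> a j <= a i.
Proof.
elim: k => [_|k IH kU].
  by exists finset.set0; [rewrite finset.sub0set cards0|move=> i j; rewrite inE].
have [T [TU Tk] Ta] := IH (ltnW kU).
have /card_gt0P[x0 x0U] : (0 < #|U :\: T|)%N.
  by rewrite cardsD (finset.setIidPr TU) Tk subn_gt0.
have [x xU xmax] : exists2 x, x \in U :\: T & forall j, j \in U :\: T -> a j <= a x.
  by case: (@arg_maxP _ R _ x0 (mem (U :\: T)) a x0U) => x ? ?; exists x.
exists (x |: T).
  move: xU; rewrite inE => /andP[xT xU]; split.
    by rewrite finset.subUset finset.sub1set xU.
  by rewrite cardsU1 xT Tk.
move=> i j; rewrite !inE => /orP[/eqP ->|iT] /andP[]; rewrite negb_or => /andP[_ jT] jU.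
  by apply: xmax; rewrite inE jT.
by apply: Ta => //; rewrite inE jT.
Qed.

Lemma average_scale (k : nat) (x : R) : (0 < k)%N ->
  Num.sqrt k%:R * (x / k%:R) = x / Num.sqrt k%:R.
Proof.
move=> k0; have kr0 : (0 : R) < Num.sqrt k%:R by rewrite sqrtr_gt0 ltr0n.
have kr2 : Num.sqrt k%:R ^+ 2 = k%:R :> R by rewrite sqr_sqrtr.
by rewrite -[X in x / X]kr2; field; rewrite gt_eqF.
Qed.

Section shelling.
Variables (a : I -> R) (f : {set I} -> R) (theta : R) (k : nat) (U0 : {set I}).
Hypotheses (a0 : forall i, 0 <= a i) (theta0 : 0 <= theta) (k0 : (0 < k)%N).
Hypothesis fD : forall T U : {set I}, T \subset U -> f U = f T + f (U :\: T).
Hypothesis fb : forall T : {set I}, T \subset U0 -> (#|T| <= k)%N ->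
  `|f T| <= theta * Num.sqrt (\sum_(i in T) a i ^+ 2).

Let block_bound (T : {set I}) (b : R) : (#|T| <= k)%N -> 0 <= b ->
  (forall i, i \in T -> a i <= b) ->
  Num.sqrt (\sum_(i in T) a i ^+ 2) <= Num.sqrt k%:R * b.
Proof.
move=> Tk b0 ab; rewrite -(ler_pXn2r (ltn0Sn 1)) ?nnegrE ?mulr_ge0 ?sqrtr_ge0//.
rewrite exprMn (sqr_sqrtr (ler0n _ k)) sqr_sqrtr; last by apply: sumr_ge0 => i _; exact: sqr_ge0.
apply: (@le_trans _ _ (\sum_(i in T) b ^+ 2)).
  by apply: ler_sum => i iT; rewrite ler_pXn2r// ?nnegrE ?a0 ?ab.
by rewrite sumr_const -[leLHS]mulr_natl ler_wpM2r ?sqr_ge0// ler_nat.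
Qed.

(** [f] is an additive set function, small on blocks of at most [k] elements.
    Removing the [k] largest entries repeatedly, each block has a Euclidean norm
    of at most [sqrt k] times the average of the previous block; [b],
    a bound of the entries in [U], plays the part of the average of the block
    removed before [U]. *)
Lemma shelling_bound (U : {set I}) (b : R) : U \subset U0 -> 0 <= b ->
  (forall i, i \in U -> a i <= b) ->
  `|f U| <= theta * (Num.sqrt k%:R * b + (\sum_(i in U) a i) / Num.sqrt k%:R).
Proof.
have [n] := ubnP #|U|; elim: n U b => // n IH U b /ltnSE Un UU0 b0 ab.
have [Uk|kU] := leqP #|U| k.
  apply: le_trans (fb UU0 Uk) _; rewrite ler_wpM2l//.
  apply: le_trans (block_bound Uk b0 ab) _.
  by rewrite lerDl divr_ge0 ?sumr_ge0// sqrtr_ge0.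
have [T [TU Tk] Ta] := largest_subset a (ltnW kU).
have kra i : i \in U :\: T -> a i <= (\sum_(j in T) a j) / k%:R.
  move=> iU; rewrite ler_pdivlMr ?ltr0n// mulrC mulr_natl.
  by rewrite -[in leLHS]Tk -sumr_const; apply: ler_sum => j jT; exact: Ta.
have cUT : (#|U :\: T| < n)%N.
  apply: leq_trans Un; rewrite cardsD (finset.setIidPr TU) Tk.
  by rewrite ltn_subrL k0 (leq_ltn_trans _ kU).
have ST0 : 0 <= \sum_(j in T) a j by apply: sumr_ge0.
have h1 := IH (U :\: T) ((\sum_(j in T) a j) / k%:R) cUT
  (fintype.subset_trans (finset.subsetDl _ _) UU0) (divr_ge0 ST0 (ler0n _ _)) kra.
have Tk' : (#|T| <= k)%N by rewrite Tk.
have h2 := fb (fintype.subset_trans TU UU0) Tk'.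
have h3 := block_bound Tk' b0 (fun i iT => ab i (fintype.subsetP TU i iT)).
rewrite (fD TU); apply: le_trans (ler_normD _ _) _.
apply: le_trans (lerD (le_trans h2 (ler_wpM2l theta0 h3)) h1) _.
rewrite [\sum_(i in U) _](finset.big_setID T)/= (finset.setIidPr TU) -mulrDr ler_wpM2l// lerD2l.
by rewrite mulrDl lerD2r average_scale.
Qed.

End shelling.

(** Once the [k] largest entries of [U] are removed, the remaining ones are
    controlled by the average of the removed ones.  The removed block is chosen
    before [f], since the functional of interest depends on it. *)
Lemma shelling_tail (a : I -> R) (k : nat) (U : {set I}) :
  (forall i, 0 <= a i) -> (0 < k)%N ->
  exists T1 : {set I}, [/\ T1 \subset U, (#|T1| <= k)%N,
    \sum_(i in U :\: T1) a i ^+ 2 <= (\sum_(i in U) a i) ^+ 2 / k%:R &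
    forall (f : {set I} -> R) (theta : R), 0 <= theta ->
    (forall T V : {set I}, T \subset V -> f V = f T + f (V :\: T)) ->
    (forall T : {set I}, T \subset U :\: T1 -> (#|T| <= k)%N ->
      `|f T| <= theta * Num.sqrt (\sum_(i in T) a i ^+ 2)) ->
    `|f (U :\: T1)| <= theta * ((\sum_(i in U) a i) / Num.sqrt k%:R)].
Proof.
move=> a0 k0; have SU0 : 0 <= \sum_(i in U) a i by apply: sumr_ge0.
have [Uk|kU] := leqP #|U| k.
  exists U; rewrite finset.setDv; split=> //.
    by rewrite big_set0 divr_ge0 ?sqr_ge0.
  move=> f theta theta0 fD _.
  have := fD finset.set0 _ (finset.sub0set finset.set0); rewrite finset.setDv.
  move=> /eqP; rewrite -subr_eq subrr => /eqP <-.
  by rewrite normr0 mulr_ge0// divr_ge0// sqrtr_ge0.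
have [T [TU Tk] Ta] := largest_subset a (ltnW kU).
have kra i : i \in U :\: T -> a i <= (\sum_(j in T) a j) / k%:R.
  move=> iU; rewrite ler_pdivlMr ?ltr0n// mulrC mulr_natl.
  by rewrite -[in leLHS]Tk -sumr_const; apply: ler_sum => j jT; exact: Ta.
have ST0 : 0 <= \sum_(j in T) a j by apply: sumr_ge0.
have SD0 : 0 <= \sum_(j in U :\: T) a j by apply: sumr_ge0.
have SUE : \sum_(i in U) a i = \sum_(j in T) a j + \sum_(j in U :\: T) a j.
  by rewrite [\sum_(i in U) _](finset.big_setID T)/= (finset.setIidPr TU).
exists T; split=> //; first by rewrite Tk.
  apply: (@le_trans _ _ (\sum_(i in U :\: T) (\sum_(j in T) a j) / k%:R * a i)).
    by apply: ler_sum => i iU; rewrite expr2 ler_wpM2r// kra.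
  rewrite -mulr_sumr SUE mulrAC ler_wpM2r ?invr_ge0//; nra.
move=> f theta theta0 fD fb.
have := shelling_bound a0 theta0 k0 fD fb (fintype.subxx _)
  (divr_ge0 ST0 (ler0n _ _)) kra.
by move=> /le_trans; apply; rewrite ler_wpM2l// SUE mulrDl lerD2r average_scale.
Qed.

End sums.

(** * Vectors *)

Section vectors.
Variable R : realType.

(** The standard inner product. *)
Definition dotv (n : nat) (x y : 'cV[R]_n) : R := \sum_(i < n) x i 0 * y i 0.

(** The vector equal to [x] on [T] and to [0] elsewhere. *)
Definition restrict (p : nat) (T : {set 'I_p}) (x : 'cV[R]_p) : 'cV[R]_p :=
  \col_j (if j \in T then x j 0 else 0).

Lemma norm2_ge0 n (x : 'cV[R]_n) : 0 <= norm2 x.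
Proof. exact: sqrtr_ge0. Qed.

Lemma norm2_sq n (x : 'cV[R]_n) : norm2 x ^+ 2 = \sum_(i < n) x i 0 ^+ 2.
Proof. by rewrite sqr_sqrtr// sumr_ge0// => i _; exact: sqr_ge0. Qed.

Lemma norm2_dotv n (x : 'cV[R]_n) : norm2 x ^+ 2 = dotv x x.
Proof. by rewrite norm2_sq; apply: eq_bigr => i _; rewrite expr2. Qed.

Lemma norm20 n : norm2 (0 : 'cV[R]_n) = 0.
Proof. by rewrite /norm2 big1 ?sqrtr0// => i _; rewrite mxE expr0n. Qed.

Lemma norm2_eq0 n (x : 'cV[R]_n) : norm2 x = 0 -> x = 0.
Proof.
move=> x0; have := norm2_sq x; rewrite x0 expr0n/= => /esym/eqP.
rewrite psumr_eq0 => [/allP h|i _]; last exact: sqr_ge0.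
apply/colP => i; rewrite mxE; have := h i (mem_index_enum i).
by rewrite sqrf_eq0 => /eqP.
Qed.

Lemma norm2_gt0 n (x : 'cV[R]_n) : x != 0 -> 0 < norm2 x.
Proof.
by move=> x0; rewrite lt_def norm2_ge0 andbT; apply: contra x0 => /eqP/norm2_eq0->.
Qed.

Lemma dotvC n (x y : 'cV[R]_n) : dotv x y = dotv y x.
Proof. by apply: eq_bigr => i _; rewrite mulrC. Qed.

Lemma dotvDr n (x y z : 'cV[R]_n) : dotv x (y + z) = dotv x y + dotv x z.
Proof. by rewrite -big_split; apply: eq_bigr => i _; rewrite mxE mulrDr. Qed.

Lemma dotvBr n (x y z : 'cV[R]_n) : dotv x (y - z) = dotv x y - dotv x z.
Proof. by rewrite -sumrB; apply: eq_bigr => i _; rewrite !mxE mulrBr. Qed.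

Lemma dotvZr n (x y : 'cV[R]_n) (a : R) : dotv x (a *: y) = a * dotv x y.
Proof. by rewrite mulr_sumr; apply: eq_bigr => i _; rewrite mxE mulrCA. Qed.

Lemma mul_tr_dotv n (x y : 'cV[R]_n) : (x^T *m y) 0 0 = dotv x y.
Proof. by rewrite mxE; apply: eq_bigr => i _; rewrite mxE. Qed.

Lemma dotv_mul_tr n p (W : 'M[R]_(n, p)) (x : 'cV[R]_p) (y : 'cV[R]_n) :
  dotv (W *m x) y = dotv x (W^T *m y).
Proof. by rewrite -!mul_tr_dotv trmx_mul mulmxA. Qed.

Lemma mul_tr_col n p (W : 'M[R]_(n, p)) (y : 'cV[R]_n) j :
  (W^T *m y) j 0 = dotv (col j W) y.
Proof. by rewrite mxE; apply: eq_bigr => i _; rewrite !mxE. Qed.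

Lemma dotv_le n (x y : 'cV[R]_n) : `|dotv x y| <= norm2 x * norm2 y.
Proof.
have h z : dotv z y <= norm2 z * norm2 y by exact: sum_cauchy_schwarz.
rewrite ler_norml h andbT lerNl.
have -> : norm2 x = norm2 (- x).
  by congr Num.sqrt; apply: eq_bigr => i _; rewrite mxE sqrrN.
by apply: le_trans (h (- x)); rewrite /dotv -sumrN ler_sum// => i _; rewrite mxE mulNr.
Qed.

Lemma dotv_le1 n (x y : 'cV[R]_n) (b : R) : (forall i, `|y i 0| <= b) ->
  `|dotv x y| <= b * norm1 x.
Proof.
move=> yb; apply: le_trans (ler_norm_sum _ _ _) _; rewrite mulr_sumr ler_sum// => i _.
by rewrite normrM mulrC ler_wpM2r.
Qed.

Lemma restrict_split p (T U : {set 'I_p}) (x : 'cV[R]_p) : T \subset U ->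
  restrict U x = restrict T x + restrict (U :\: T) x.
Proof.
move=> TU; apply/colP => j; have := fintype.subsetP TU j.
rewrite !mxE finset.in_setD.
by case: (j \in T); case: (j \in U) => //= UT; rewrite ?addr0 ?add0r//; have := UT isT.
Qed.

Lemma norm2_restrict_sq p (T : {set 'I_p}) (x : 'cV[R]_p) :
  norm2 (restrict T x) ^+ 2 = \sum_(j in T) x j 0 ^+ 2.
Proof.
rewrite norm2_sq [RHS]big_mkcond/=; apply: eq_bigr => j _; rewrite mxE.
by case: ifP => // _; rewrite expr0n.
Qed.

Lemma norm2_restrict p (T : {set 'I_p}) (x : 'cV[R]_p) :
  norm2 (restrict T x) = Num.sqrt (\sum_(j in T) `|x j 0| ^+ 2).
Proof.
rewrite -[LHS]ger0_norm ?norm2_ge0// -sqrtr_sqr norm2_restrict_sq.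
by under [in RHS]eq_bigr do rewrite real_normK ?num_real//.
Qed.

Lemma norm1_restrict p (T : {set 'I_p}) (x : 'cV[R]_p) :
  norm1 (restrict T x) = \sum_(j in T) `|x j 0|.
Proof.
rewrite /norm1 [RHS]big_mkcond/=; apply: eq_bigr => j _; rewrite mxE.
by case: ifP => // _; rewrite normr0.
Qed.

End vectors.

(** * Restricted isometry and restricted orthogonality *)

Section restricted_constants.
Variables (R : realType) (n p : nat) (Z : 'M[R]_(n, p)).
Local Notation W := (standardize Z).

Let column_le (j : 'I_p) : \sum_(i < n) W i j ^+ 2 <= 1.
Proof.
under eq_bigr do rewrite !mxE exprMn.
rewrite -mulr_suml; have := norm2_sq (col j Z).
under [X in _ = X -> _]eq_bigr do rewrite mxE.
move=> <-; have [->|Z0] := eqVneq (norm2 (col j Z)) 0; first by rewrite expr0n/= mul0r.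
by rewrite exprVn divff// sqrf_eq0.
Qed.

(* Crude bounds: they show only that the infima are taken over nonempty sets. *)
Let mul_le (x : 'cV[R]_p) : norm2 (W *m x) ^+ 2 <= p%:R * norm2 x ^+ 2.
Proof.
have e i : (W *m x) i 0 ^+ 2 <= (\sum_(j < p) W i j ^+ 2) * norm2 x ^+ 2.
  have := dotv_le (row i W)^T x; rewrite -mul_tr_dotv trmxK -row_mul mxE.
  move=> h; rewrite -[leLHS]real_normK ?num_real//.
  apply: (le_trans (_ : _ <= (norm2 (row i W)^T * norm2 x) ^+ 2)).
    by rewrite ler_pXn2r ?nnegrE ?mulr_ge0 ?norm2_ge0.
  rewrite exprMn ler_wpM2r ?sqr_ge0// norm2_sq ler_sum// => j _.
  by rewrite !mxE.
rewrite norm2_sq; apply: le_trans (ler_sum _ (fun i _ => e i)) _.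
rewrite -mulr_suml ler_wpM2r ?sqr_ge0// exchange_big/=.
apply: (@le_trans _ _ (\sum_(j < p) 1)); last by rewrite sumr_const card_ord.
by apply: ler_sum => j _; exact: column_le.
Qed.

(* The vector with entries [c] on [T] and zero elsewhere. *)
Let extend (T : {set 'I_p}) (c : 'cV[R]_#|T|) : 'cV[R]_p :=
  (rowsub (@enum_val _ (mem T)) (1%:M : 'M[R]_p))^T *m c.

Let extendE (T : {set 'I_p}) (c : 'cV[R]_#|T|) (F : R -> R) : F 0 = 0 ->
  \sum_(j < p) F (extend c j 0) = \sum_(k < #|T|) F (c k 0).
Proof.
move=> F0.
have ev k : extend c (enum_val k) 0 = c k 0.
  rewrite mxE (bigD1 k)//= !mxE eqxx mul1r big1 ?addr0// => l lk.
  by rewrite !mxE (inj_eq enum_val_inj) (negbTE lk) mul0r.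
have e0 j : j \notin T -> extend c j 0 = 0.
  move=> jT; rewrite mxE big1// => l _; rewrite !mxE.
  have [e|_] := eqVneq (enum_val l) j; last by rewrite mul0r.
  by rewrite -e enum_valP in jT.
rewrite (bigID (mem T))/= [X in _ + X]big1 ?addr0 => [|j /e0->//].
by rewrite big_enum_val/=; apply: eq_bigr => k _; rewrite ev.
Qed.

Let norm2_extend (T : {set 'I_p}) (c : 'cV[R]_#|T|) : norm2 (extend c) = norm2 c.
Proof. by congr Num.sqrt; apply: (extendE c (F := fun x => x ^+ 2)); rewrite expr0n. Qed.

Let mul_extend (T : {set 'I_p}) (c : 'cV[R]_#|T|) : std_cols Z T *m c = W *m extend c.
Proof.
rewrite /extend mulmxA; congr (_ *m _); apply/matrixP => i k.
rewrite !mxE (bigD1 (enum_val k))//= !mxE eqxx mulr1 big1 ?addr0// => j jk.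
by rewrite !mxE eq_sym (negbTE jk) mulr0.
Qed.

Let extend_restrict (T : {set 'I_p}) (x : 'cV[R]_p) :
  extend (rowsub (@enum_val _ (mem T)) x) = restrict T x.
Proof.
apply/colP => j; rewrite !mxE; case: ifPn => jT.
  rewrite (bigD1 (enum_rank_in jT j))//= !mxE enum_rankK_in// eqxx mul1r big1 ?addr0//.
  move=> l lj; rewrite !mxE; case: eqP => [e|_]; last by rewrite mul0r.
  by case/eqP: lj; apply: enum_val_inj; rewrite enum_rankK_in.
rewrite big1// => l _; rewrite !mxE; case: eqP => [e|_]; last by rewrite mul0r.
by rewrite -e enum_valP in jT.
Qed.

(* The sets of admissible constants. *)
Let isometry_set (S : nat) := [set delta : R | 0 <= delta /\
    forall T : {set 'I_p}, (#|T| <= S)%N -> forall c : 'cV[R]_#|T|,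
      (1 - delta) * norm2 c ^+ 2 <= norm2 (std_cols Z T *m c) ^+ 2
        <= (1 + delta) * norm2 c ^+ 2].

Let orthogonality_set (S S' : nat) := [set theta : R | 0 <= theta /\
    forall T T' : {set 'I_p}, (#|T| <= S)%N -> (#|T'| <= S')%N ->
      [disjoint T & T']%B -> forall (c : 'cV[R]_#|T|) (c' : 'cV[R]_#|T'|),
      `|((std_cols Z T *m c)^T *m (std_cols Z T' *m c')) 0 0|
        <= theta * norm2 c * norm2 c'].

Let isometry_set_nonempty S : isometry_set S !=set0.
Proof.
exists (p%:R + 1); split=> [|T _ c]; first by rewrite addr_ge0.
rewrite mul_extend -(norm2_extend c).
have := mul_le (extend c); have := sqr_ge0 (norm2 (W *m extend c)).
have p0 : (0 : R) <= p%:R by [].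
have := sqr_ge0 (norm2 (extend c)) => n0 n1 n2.
apply/andP; split; nra.
Qed.

Let orthogonality_set_nonempty S S' : orthogonality_set S S' !=set0.
Proof.
exists p%:R; split=> // T T' _ _ _ c c'.
rewrite !mul_extend -(norm2_extend c) -(norm2_extend c') mul_tr_dotv.
apply: le_trans (dotv_le _ _) _.
rewrite -(ler_pXn2r (ltn0Sn 1)) ?nnegrE ?mulr_ge0 ?norm2_ge0//.
rewrite !exprMn [leRHS](_ : _ = (p%:R * norm2 (extend c) ^+ 2) *
  (p%:R * norm2 (extend c') ^+ 2)); last by ring.
by apply: ler_pM; rewrite ?sqr_ge0 ?mul_le.
Qed.

Lemma restricted_orthogonality_ge0 S S' : 0 <= restricted_orthogonality Z S S'.
Proof. by apply: (lb_le_inf (orthogonality_set_nonempty S S')) => x []. Qed.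

Lemma restricted_isometry_mono S1 S2 : (S1 <= S2)%N ->
  restricted_isometry Z S1 <= restricted_isometry Z S2.
Proof.
move=> S12; apply: (lb_le_inf (isometry_set_nonempty S2)) => x [x0 xP].
apply: ge_inf; first by exists 0 => y [].
by split=> // T TS; apply: xP; exact: leq_trans S12.
Qed.

Lemma restricted_orthogonality_mono S1 S2 S1' S2' : (S1 <= S2)%N ->
  (S1' <= S2')%N ->
  restricted_orthogonality Z S1 S1' <= restricted_orthogonality Z S2 S2'.
Proof.
move=> S12 S12'; apply: (lb_le_inf (orthogonality_set_nonempty S2 S2')) => x [x0 xP].
apply: ge_inf; first by exists 0 => y [].
by split=> // T T' TS TS'; apply: xP; [exact: leq_trans S12|exact: leq_trans S12'].
Qed.

(** The infimum defining the restricted isometry constant is attained; only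
    the lower bound matters for the error bound. *)
Lemma restricted_isometry_lower S (T : {set 'I_p}) (x : 'cV[R]_p) :
  (#|T| <= S)%N ->
  (1 - restricted_isometry Z S) * norm2 (restrict T x) ^+ 2 <=
    norm2 (W *m restrict T x) ^+ 2.
Proof.
move=> TS; set y := restrict T x.
have [->|y0] := eqVneq y 0; first by rewrite norm20 expr0n/= mulr0 sqr_ge0.
have n0 : 0 < norm2 y ^+ 2 by rewrite exprn_gt0 ?norm2_gt0.
rewrite -ler_pdivlMr// lerBlDr addrC -lerBlDr.
apply: (lb_le_inf (isometry_set_nonempty S)) => delta.
move=> [_ /(_ T TS (rowsub (@enum_val _ (mem T)) x))].
rewrite mul_extend -norm2_extend extend_restrict -/y => /andP[h _].
by rewrite lerBlDr addrC -lerBlDr ler_pdivlMr.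
Qed.

(** The infimum defining the restricted orthogonality constant is attained. *)
Lemma restricted_orthogonality_upper S S' (T T' : {set 'I_p}) (x y : 'cV[R]_p) :
  (#|T| <= S)%N -> (#|T'| <= S')%N -> [disjoint T & T']%B ->
  `|dotv (W *m restrict T x) (W *m restrict T' y)| <=
    restricted_orthogonality Z S S' * norm2 (restrict T x) * norm2 (restrict T' y).
Proof.
move=> TS TS' TT'; set u := restrict T x; set v := restrict T' y.
have [->|u0] := eqVneq u 0.
  rewrite norm20 mulr0 mul0r mulmx0 /dotv big1 ?normr0// => i _.
  by rewrite mxE mul0r.
have [->|v0] := eqVneq v 0.
  rewrite norm20 mulr0 mulmx0 /dotv big1 ?normr0// => i _.
  by rewrite [X in _ * X]mxE mulr0.
have n0 : 0 < norm2 u * norm2 v by rewrite mulr_gt0 ?norm2_gt0.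
rewrite -mulrA -ler_pdivrMr//.
apply: (lb_le_inf (orthogonality_set_nonempty S S')) => theta [_ /(_ T T' TS TS' TT'
  (rowsub (@enum_val _ (mem T)) x) (rowsub (@enum_val _ (mem T')) y))].
rewrite !mul_extend mul_tr_dotv -!norm2_extend !extend_restrict -/u -/v.
by rewrite -mulrA ler_pdivrMr.
Qed.

End restricted_constants.

(** * The Dantzig selector and the lasso *)

Section dantzig.
Variables (R : realType) (n p : nat).
Implicit Types (g gamma h : 'cV[R]_p) (y : 'cV[R]_n) (lambda : R).

Lemma norm1_split (T : {set 'I_p}) g :
  norm1 g = \sum_(j in T) `|g j 0| + \sum_(j in ~: T) `|g j 0|.
Proof.
rewrite /norm1 (bigID (mem T))/=; congr (_ + _).
by apply: eq_bigl => j; rewrite finset.in_setC.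
Qed.

Lemma notin_supp g j : j \notin supp g -> g j 0 = 0.
Proof. by rewrite /supp inE negbK => /eqP. Qed.

(** The feasible vector [gamma] cannot beat [g] in l1 norm, so most of the
    difference lies on the support of [gamma]. *)
Lemma dantzig_cone (W : 'M[R]_(n, p)) y lambda g gamma :
  is_dantzig W y lambda g -> dantzig_feasible W y lambda gamma ->
  \sum_(j in ~: supp gamma) `|(g - gamma) j 0| <=
  \sum_(j in supp gamma) `|(g - gamma) j 0|.
Proof.
move=> [_ gmin] /gmin; rewrite (norm1_split (supp gamma) g).
rewrite (norm1_split (supp gamma) gamma) [X in _ <= _ + X]big1 ?addr0; last first.
  by move=> j; rewrite finset.in_setC => /notin_supp ->; rewrite normr0.
have -> : \sum_(j in ~: supp gamma) `|(g - gamma) j 0| =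
    \sum_(j in ~: supp gamma) `|g j 0|.
  apply: eq_bigr => j; rewrite finset.in_setC => /notin_supp e.
  by rewrite !mxE e subr0.
have : \sum_(j in supp gamma) `|gamma j 0| - \sum_(j in supp gamma) `|g j 0| <=
    \sum_(j in supp gamma) `|(g - gamma) j 0|.
  rewrite -sumrB; apply: ler_sum => j _; rewrite !mxE distrC.
  exact: lerB_dist.
lra.
Qed.

Lemma dantzig_correlation (W : 'M[R]_(n, p)) y lambda g gamma j :
  dantzig_feasible W y lambda g -> dantzig_feasible W y lambda gamma ->
  `|(W^T *m (W *m (g - gamma))) j 0| <= 2 * lambda.
Proof.
move=> /(_ j); rewrite mul_tr_dotv => h1 /(_ j); rewrite mul_tr_dotv => h2.
rewrite mul_tr_col.
have -> : W *m (g - gamma) = (y - W *m gamma) - (y - W *m g).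
  by rewrite mulmxBr opprB [RHS]addrC addrA subrK.
rewrite dotvBr; apply: le_trans (ler_normB _ _) _; lra.
Qed.

(** The error bound of Candes and Tao: a sparse feasible vector is recovered
    up to an error proportional to the tuning parameter. *)
Lemma dantzig_error (Z : 'M[R]_(n, p)) y lambda g gamma (S : nat) :
  0 <= lambda ->
  is_dantzig (standardize Z) y lambda g ->
  dantzig_feasible (standardize Z) y lambda gamma ->
  (#|supp gamma| <= S)%N ->
  restricted_isometry Z (2 * S) + restricted_orthogonality Z S (2 * S) < 1 ->
  norm2 (g - gamma) <= 4 * lambda * Num.sqrt S%:R /
    (1 - restricted_isometry Z (2 * S) - restricted_orthogonality Z S (2 * S)).
Proof.
move=> lambda0 gD gF gS dt1.
set W := standardize Z in gD gF *; set h := g - gamma.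
set delta := restricted_isometry Z (2 * S) in dt1 *.
set theta := restricted_orthogonality Z S (2 * S) in dt1 *.
have theta0 : 0 <= theta by exact: restricted_orthogonality_ge0.
have den0 : 0 < 1 - delta - theta by lra.
have cone := dantzig_cone gD gF; rewrite -/h in cone.
have corr j := dantzig_correlation j gD.1 gF; rewrite -/h in corr.
set T0 := supp gamma in gS cone.
have [S0|S0] := posnP S.
  rewrite S0 sqrtr0 mulr0 mul0r.
  have T00 : T0 = finset.set0 by apply/eqP; rewrite -cards_eq0 -leqn0 -S0.
  suff -> : h = 0 by rewrite norm20.
  move: cone; rewrite T00 big_set0 => c0; apply/colP => j; rewrite [RHS]mxE.
  have : \sum_(j in ~: finset.set0) `|h j 0| == 0 by rewrite eq_le c0 sumr_ge0.
  rewrite psumr_eq0// => /allP /(_ j (mem_index_enum j)).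
  by rewrite finset.in_setC finset.in_set0 normr_eq0 => /eqP.
set a := fun j => `|h j 0|.
pose sS : R := Num.sqrt S%:R.
have sS0 : 0 < sS by rewrite sqrtr_gt0 ltr0n.
have sS2 : sS ^+ 2 = S%:R by rewrite sqr_sqrtr.
have headle : \sum_(j in T0) a j <= sS * norm2 (restrict T0 h).
  apply: le_trans (sum_le_sqrt_card _ _) _; rewrite -norm2_restrict.
  by rewrite ler_wpM2r ?norm2_ge0// ler_wsqrtr// ler_nat.
have tail1 : (\sum_(j in ~: T0) a j) / sS <= norm2 (restrict T0 h).
  by rewrite ler_pdivrMr// mulrC; exact: le_trans cone headle.
(* [T1] carries the largest entries of [h] outside the support [T0]; [x] is the
   part of [h] on [T0] and [T1], and [y1] is the rest. *)
have [T1 [T1U T1S sq_tail shell]] :=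
  shelling_tail (a := a) (~: T0) (fun j => normr_ge0 _) S0.
set U1 := ~: T0 :\: T1 in sq_tail shell.
set T01 := T0 :|: T1.
have U1E : U1 = ~: T01 by rewrite /U1 /T01 finset.setCU finset.setDE.
have T01S : (#|T01| <= 2 * S)%N.
  by rewrite mul2n -addnn (leq_trans (leq_card_setU _ _))// leq_add.
set x := restrict T01 h; set y1 := restrict U1 h.
have hE : h = x + y1.
  apply/colP => j; rewrite !mxE U1E finset.in_setC.
  by case: (j \in T01); rewrite /= ?addr0 ?add0r.
have headx : norm2 (restrict T0 h) <= norm2 x.
  rewrite -(ler_pXn2r (ltn0Sn 1)) ?nnegrE ?norm2_ge0// !norm2_restrict_sq.
  rewrite [leRHS](finset.big_setID T0)/= (finset.setIidPr (finset.subsetUl _ _)).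
  by rewrite lerDl sumr_ge0// => j _; exact: sqr_ge0.
have tail2 : (\sum_(j in ~: T0) a j) / sS <= norm2 x by exact: le_trans headx.
have y1x : norm2 y1 ^+ 2 <= norm2 x ^+ 2.
  rewrite norm2_restrict_sq.
  have -> : \sum_(j in U1) h j 0 ^+ 2 = \sum_(j in U1) a j ^+ 2.
    by apply: eq_bigr => j _; rewrite real_normK ?num_real.
  apply: le_trans sq_tail _; rewrite -sS2 -expr_div_n.
  have q0 : 0 <= (\sum_(j in ~: T0) a j) / sS.
    by rewrite divr_ge0 ?(ltW sS0)// sumr_ge0// => j _; exact: normr_ge0.
  by rewrite ler_pXn2r ?nnegrE ?norm2_ge0.
have n1x : norm1 x <= Num.sqrt (2 * S)%:R * norm2 x.
  rewrite norm1_restrict; apply: le_trans (sum_le_sqrt_card _ _) _.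
  by rewrite -norm2_restrict ler_wpM2r ?norm2_ge0// ler_wsqrtr// ler_nat.
have inner : norm2 (W *m x) ^+ 2 = dotv x (W^T *m (W *m h)) - dotv (W *m x) (W *m y1).
  by rewrite -dotv_mul_tr norm2_dotv hE mulmxDr dotvDr addrK.
have main : (1 - delta - theta) * norm2 x ^+ 2 <=
    2 * lambda * (Num.sqrt (2 * S)%:R * norm2 x).
  have lower := restricted_isometry_lower Z h T01S.
  rewrite -/delta -/W -/x inner in lower.
  have first : dotv x (W^T *m (W *m h)) <= 2 * lambda * (Num.sqrt (2 * S)%:R * norm2 x).
    apply: le_trans (ler_norm _) _; apply: le_trans (dotv_le1 x corr) _.
    by rewrite ler_wpM2l// mulr_ge0.
  have second : `|dotv (W *m x) (W *m y1)| <= theta * norm2 x * norm2 x.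
    have th0 : 0 <= theta * norm2 x by rewrite mulr_ge0 ?norm2_ge0.
    apply: le_trans (shell (fun T => dotv (W *m x) (W *m restrict T h)) _ th0 _ _) _.
    - by move=> T V TV; rewrite (restrict_split h TV) mulmxDr dotvDr.
    - move=> T TU TS; rewrite -norm2_restrict mulrAC dotvC.
      apply: restricted_orthogonality_upper => //.
      by rewrite finset.disjoints_subset -U1E.
    - by rewrite ler_wpM2l.
  have := le_trans (ler_norm (- dotv (W *m x) (W *m y1))) _.
  rewrite normrN => /(_ _ second) third.
  move: lower first third; rewrite !expr2; lra.
(* Divide by the norm of [x], which may vanish. *)
have xle : (1 - delta - theta) * norm2 x <= 2 * lambda * Num.sqrt (2 * S)%:R.
  have [->|x0] := eqVneq (norm2 x) 0.
    by rewrite mulr0 !mulr_ge0 ?sqrtr_ge0.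
  have xgt0 : 0 < norm2 x by rewrite lt_def x0 norm2_ge0.
  by rewrite -(ler_pM2r xgt0) -!mulrA -expr2 mulrA.
have hx : norm2 h <= Num.sqrt 2 * norm2 x.
  rewrite -(ler_pXn2r (ltn0Sn 1)) ?nnegrE ?mulr_ge0 ?sqrtr_ge0 ?norm2_ge0//.
  rewrite exprMn (sqr_sqrtr (ler0n _ 2)).
  have -> : norm2 h ^+ 2 = norm2 x ^+ 2 + norm2 y1 ^+ 2.
    rewrite !norm2_restrict_sq norm2_sq (bigID (mem T01))/=; congr (_ + _).
    by apply: eq_bigl => j; rewrite U1E finset.in_setC.
  lra.
rewrite ler_pdivlMr//; apply: le_trans (ler_wpM2r (ltW den0) hx) _.
rewrite -(mulrA (Num.sqrt 2)) [norm2 x * (1 - _ - _)]mulrC.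
apply: le_trans (ler_wpM2l (sqrtr_ge0 _) xle) _.
rewrite natrM sqrtrM//.
have : Num.sqrt 2 ^+ 2 = 2 :> R by rewrite sqr_sqrtr.
set r2 := Num.sqrt 2; rewrite -/sS => r22.
rewrite [leLHS](_ : _ = r2 ^+ 2 * 2 * lambda * sS); last by ring.
rewrite r22; lra.
Qed.

End dantzig.

Section lasso.
Variables (R : realType) (n p : nat).
Implicit Types (g h : 'cV[R]_p) (y : 'cV[R]_n) (lambda : R).

(** Passage to the limit in the difference quotients of the lasso objective. *)
Lemma le0_of_small_slope (a b d : R) : 0 < d -> 0 <= b ->
  (forall t, 0 < t -> t <= d -> a <= t * b) -> a <= 0.
Proof.
move=> d0 b0 h; rewrite leNgt; apply/negP => a0.
pose t := Num.min d (a / (2 * (b + 1))).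
have b1 : 0 < 2 * (b + 1) by lra.
have t0 : 0 < t by rewrite lt_min d0 divr_gt0.
have td : t <= d by rewrite ge_min lexx.
have ta : t * (2 * (b + 1)) <= a by rewrite -ler_pdivlMr// ge_min lexx orbT.
have := h t t0 td; nra.
Qed.

(** A move of size [s] along a coordinate axis does not improve a lasso
    solution. *)
Lemma lasso_coordinate (W : 'M[R]_(n, p)) y lambda g j (s : R) :
  is_lasso W y lambda g ->
  s * (W^T *m (y - W *m g)) j 0 <=
    s ^+ 2 / 2 * norm2 (col j W) ^+ 2 + lambda * (`|g j 0 + s| - `|g j 0|).
Proof.
move=> /(_ (g + s *: delta_mx j 0)).
set r := y - W *m g.
have -> : y - W *m (g + s *: delta_mx j 0) = r - s *: col j W.
  by rewrite mulmxDr -scalemxAr -colE opprD addrA.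
clearbody r.
have -> : norm1 (g + s *: delta_mx j 0) = norm1 g + (`|g j 0 + s| - `|g j 0|).
  rewrite /norm1 (bigD1 j)//= [in RHS](bigD1 j)//=.
  rewrite (eq_bigr (fun i => `|g i 0|)) => [|i ij]; last first.
    by rewrite !mxE (negbTE ij) mulr0 addr0.
  by rewrite !mxE !eqxx mulr1; ring.
have -> : norm2 (r - s *: col j W) ^+ 2 =
    norm2 r ^+ 2 - 2 * (s * dotv (col j W) r) + s ^+ 2 * norm2 (col j W) ^+ 2.
  rewrite !norm2_dotv dotvBr dotvZr ![dotv (r - _) _]dotvC !dotvBr !dotvZr.
  by rewrite (dotvC r (col j W)); ring.
rewrite mul_tr_col; lra.
Qed.

(** The first half of the optimality conditions of the lasso; the second is
    [lasso_support]. *)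
Lemma lasso_feasible (W : 'M[R]_(n, p)) y lambda g : 0 <= lambda ->
  is_lasso W y lambda g -> dantzig_feasible W y lambda g.
Proof.
move=> l0 gL j; rewrite mul_tr_dotv -mul_tr_col.
set c := _ j 0; set w := norm2 (col j W) ^+ 2.
have w0 : 0 <= w by rewrite sqr_ge0.
have ineq s : s * c <= s ^+ 2 / 2 * w + lambda * `|s|.
  apply: le_trans (lasso_coordinate j s gL) _; rewrite lerD2l ler_wpM2l//.
  by rewrite lerBlDl ler_normD.
rewrite ler_norml; apply/andP; split.
  rewrite -subr_le0; apply: (@le0_of_small_slope _ (w / 2) 1); rewrite ?divr_ge0//.
  move=> t t0 _; have := ineq (- t); rewrite normrN gtr0_norm// sqrrN => i1.
  by rewrite -(ler_pM2l t0); nra.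
rewrite -subr_le0; apply: (@le0_of_small_slope _ (w / 2) 1); rewrite ?divr_ge0//.
move=> t t0 _; have := ineq t; rewrite gtr0_norm// => i1.
by rewrite -(ler_pM2l t0); nra.
Qed.

Lemma lasso_support (W : 'M[R]_(n, p)) y lambda g j : 0 <= lambda ->
  is_lasso W y lambda g -> g j 0 != 0 ->
  (W^T *m (y - W *m g)) j 0 = lambda * Num.sg (g j 0).
Proof.
move=> l0 gL gj0; have := lasso_feasible l0 gL j; rewrite mul_tr_dotv -mul_tr_col.
have := fun s => lasso_coordinate j s gL.
set c := _ j 0; set w := norm2 (col j W) ^+ 2 => ineq; rewrite ler_norml => /andP[c1 c2].
have w0 : 0 <= w by rewrite sqr_ge0.
have [gp|gn|g0] := ltgtP 0 (g j 0); last by rewrite -g0 eqxx in gj0.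
- rewrite gtr0_sg// mulr1; apply/le_anti; rewrite c2/= -subr_le0.
  apply: (@le0_of_small_slope _ (w / 2) (g j 0)); rewrite ?divr_ge0//.
  move=> t t0 tg; have := ineq (- t); rewrite sqrrN (gtr0_norm gp) ger0_norm ?subr_ge0//.
  by move=> i1; rewrite -(ler_pM2l t0); nra.
- rewrite ltr0_sg// mulrN1; apply/le_anti; rewrite c1 andbT -subr_le0.
  apply: (@le0_of_small_slope _ (w / 2) (- g j 0)); rewrite ?divr_ge0// ?oppr_gt0//.
  move=> t t0 tg; have := ineq t; rewrite (ltr0_norm gn) ler0_norm; last lra.
  by move=> i1; rewrite -(ler_pM2l t0); nra.
Qed.

(** On the support, the equation defining [u] says that the correlations of
    [W D u] with the columns of [W] are the signs. *)
Lemma dual_vec_support (W : 'M[R]_(n, p)) g j : lasso_condition W g ->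
  g j 0 != 0 ->
  (W^T *m W *m sign_diag g *m dual_vec W g) j 0 = Num.sg (g j 0).
Proof.
move=> [unitB _ _] gj0.
set z := W^T *m W *m sign_diag g *m dual_vec W g.
have jS : j \in supp g by rewrite /supp inE.
pose v := invmx (supp_block W g) *m (const_mx 1 : 'cV[R]_#|supp g|).
pose E := (rowsub (@enum_val _ (mem (supp g))) (1%:M : 'M[R]_p))^T.
have dE : dual_vec W g = E *m v by [].
have sub (M : 'M[R]_p) : mxsub (@enum_val _ (mem (supp g)))
    (@enum_val _ (mem (supp g))) M =
    rowsub (@enum_val _ (mem (supp g))) (M *m E).
  apply/matrixP => k l; rewrite !mxE (bigD1 (enum_val l))//= !mxE eqxx mulr1.
  rewrite [X in _ + X]big1 ?addr0// => i il.
  by rewrite !mxE eq_sym (negbTE il) mulr0.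
have Bv : rowsub (@enum_val _ (mem (supp g)))
    (sign_diag g *m W^T *m W *m sign_diag g *m E *m v) = const_mx 1.
  by rewrite -mul_rowsub_mx -sub mulmxA mulmxV// mul1mx.
clearbody v; have e : (sign_diag g *m z) j 0 = 1.
  have := congr1 (fun x : 'cV[R]_#|supp g| => x (enum_rank_in jS j) 0) Bv.
  by rewrite [LHS]mxE [RHS]mxE enum_rankK_in// => <-; rewrite /z dE !mulmxA.
move: e; rewrite /sign_diag mul_diag_mx !mxE => e.
have sg2 : Num.sg (g j 0) * Num.sg (g j 0) = 1 by rewrite -expr2 sqr_sg gj0.
by rewrite -[LHS]mul1r -sg2 -mulrA [X in _ * X]e mulr1.
Qed.

(** The vector [D u] of the lasso condition is a dual certificate: it proves
    that the lasso solution also solves the Dantzig selector problem. *)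
Lemma lasso_is_dantzig (W : 'M[R]_(n, p)) y lambda g : 0 <= lambda ->
  is_lasso W y lambda g -> lasso_condition W g -> is_dantzig W y lambda g.
Proof.
move=> l0 gL gC; split; first exact: lasso_feasible.
move=> h hF.
have [_ d0 z1] := gC.
set D := sign_diag g in z1; set d := dual_vec W g in d0 z1.
set z := W^T *m W *m D *m d in z1.
have zE : z = W^T *m (W *m (D *m d)) by rewrite /z !mulmxA.
have zdot x : dotv z x = dotv (D *m d) (W^T *m (W *m x)).
  by rewrite zE dotvC -dotv_mul_tr dotvC dotv_mul_tr.
have zg : dotv z g = norm1 g.
  apply: eq_bigr => j _; have [->|gj0] := eqVneq (g j 0) 0.
    by rewrite mulr0 normr0.
  by rewrite dual_vec_support// -normrEsg.
have zh : dotv z h <= norm1 h.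
  apply: ler_sum => j _; apply: le_trans (ler_norm _) _.
  by rewrite normrM ler_piMl.
rewrite -zg; apply: le_trans zh; rewrite -subr_ge0 -dotvBr zdot.
have -> : W^T *m (W *m (h - g)) = W^T *m (y - W *m g) - W^T *m (y - W *m h).
  by rewrite -mulmxBr; congr (_ *m _); rewrite mulmxBr opprB [RHS]addrC addrA subrK.
rewrite dotvBr subr_ge0 /dotv; apply: ler_sum => j _.
have -> : (D *m d) j 0 = Num.sg (g j 0) * d j 0.
  by rewrite /D /sign_diag mul_diag_mx !mxE.
have [->|gj0] := eqVneq (g j 0) 0; first by rewrite sgr0 !mul0r.
have := hF j; rewrite mul_tr_dotv -mul_tr_col; set q := _ j 0 => hq.
rewrite (lasso_support l0 gL gj0); have sg2 : Num.sg (g j 0) ^+ 2 = 1 by rewrite sqr_sg gj0.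
have h1 : Num.sg (g j 0) * q <= lambda.
  by apply: le_trans (ler_norm _) _; rewrite normrM normr_sg gj0 mul1r.
rewrite [leRHS](_ : _ = Num.sg (g j 0) ^+ 2 * (d j 0 * lambda)); last by ring.
rewrite sg2 mul1r [leLHS](_ : _ = d j 0 * (Num.sg (g j 0) * q)); last by ring.
exact: ler_wpM2l.
Qed.

End lasso.

(** * Moments of the centered normal distribution *)

Section normal_moments.
Variable R : realType.
Local Notation mu := (@lebesgue_measure R).

(** Integration against a normal distribution is integration of the density:
    the density is the Radon-Nikodym derivative. *)
Lemma ge0_integral_normal_prob (m s : R) (f : R -> \bar R) :
  (forall x, (0 <= f x)%E) -> measurable_fun [set: R] f ->
  (\int[normal_prob m s]_x f x = \int[mu]_x (f x * (normal_pdf m s x)%:E))%E.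
Proof.
move=> f0 mf.
rewrite -(Radon_Nikodym_SigmaFinite.change_of_variables
  (normal_prob_dominates m s))//=.
have dom := normal_prob_dominates m s.
apply: ae_eq_integral => //.
- apply: emeasurable_funM => //; apply: (measurable_int mu).
  exact: Radon_Nikodym_SigmaFinite.f_integrable.
- apply: emeasurable_funM => //; apply/measurable_EFinP.
  exact: measurable_normal_pdf.
- apply: ae_eqe_mul2l => /=; apply: integral_ae_eq => //=.
  + exact: Radon_Nikodym_SigmaFinite.f_integrable.
  + by apply/measurable_EFinP; exact: measurable_normal_pdf.
  + by move=> E _ mE; rewrite -Radon_Nikodym_SigmaFinite.f_integral.
Qed.

Lemma normal_second_moment (s : R) : 0 < s ->
  (\int[normal_prob 0 s]_x (x ^+ 2)%:E < +oo)%E.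
Proof.
move=> s0; have sN0 : s != 0 by rewrite gt_eqF.
pose r := Num.sqrt 2 * s.
have r0 : 0 < r by rewrite mulr_gt0// sqrtr_gt0.
have rN0 : r != 0 by rewrite gt_eqF.
pose C := 4 * s ^+ 2 * normal_peak s / normal_peak r.
have C0 : 0 <= C.
  by rewrite divr_ge0 ?normal_peak_ge0// mulr_ge0 ?normal_peak_ge0// mulr_ge0 ?sqr_ge0.
have mX2 : measurable_fun [set: R] (fun x : R => x ^+ 2) by exact: measurable_funX.
rewrite ge0_integral_normal_prob; last 2 first.
- by move=> x; rewrite lee_fin sqr_ge0.
- exact/measurable_EFinP.
(* Half of the exponent absorbs the square, because [u <= expR u]; the other half
   is the density of a normal distribution with twice the variance. *)
apply: (@le_lt_trans _ _ (\int[mu]_x (C%:E * (normal_pdf 0 r x)%:E))%E); last first.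
  by rewrite integralZl//= ?integral_normal_pdf ?mule1 ?ltry//; exact: integrable_normal_pdf.
apply: ge0_le_integral => //=.
- by move=> x _; rewrite mule_ge0// lee_fin ?sqr_ge0 ?normal_pdf_ge0.
- apply/measurable_EFinP; apply: measurable_funM => //; exact: measurable_normal_pdf.
- by apply/measurable_EFinP; apply: measurable_funM => //; exact: measurable_normal_pdf.
move=> x _; rewrite -!EFinM lee_fin.
rewrite (normal_pdfE 0 sN0) (normal_pdfE 0 rN0) /normal_fun subr0.
set u := x ^+ 2 / (4 * s ^+ 2).
have r2 : r ^+ 2 = 2 * s ^+ 2 by rewrite exprMn sqr_sqrtr.
have -> : - x ^+ 2 / (r ^+ 2 *+ 2) = - u.
  by rewrite r2 /u -mulr_natr mulNr; congr (- (_ * _^-1)); ring.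
have -> : - x ^+ 2 / (s ^+ 2 *+ 2) = - u + - u.
  by rewrite /u; field.
have xu : x ^+ 2 = 4 * s ^+ 2 * u by rewrite /u; field.
rewrite expRD {1}xu /C.
have p0 := normal_peak_gt0 rN0; have q0 := normal_peak_gt0 sN0.
rewrite [leRHS](_ : _ = 4 * s ^+ 2 * normal_peak s * expR (- u)); last first.
  by field; rewrite gt_eqF.
rewrite [leLHS](_ : _ = 4 * s ^+ 2 * normal_peak s * expR (- u) * (u * expR (- u))); last by ring.
have K0 : 0 <= 4 * s ^+ 2 * normal_peak s * expR (- u).
  by rewrite mulr_ge0 ?expR_ge0// mulr_ge0 ?(ltW q0)// mulr_ge0 ?sqr_ge0.
apply: ler_piMr => //.
rewrite expRN ler_pdivrMr ?expR_gt0// mul1r.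
apply: le_trans (expR_ge1Dx u); lra.
Qed.

(** The Lebesgue integral is invariant under reflection. *)
Lemma ge0_integral_opp (G : R -> R) : continuous G -> (forall x, 0 <= G x) ->
  (\int[mu]_x (G x)%:E = \int[mu]_x (G (- x))%:E)%E.
Proof.
have half (F : R -> R) : continuous F -> (forall x, 0 <= F x) ->
    (\int[mu]_x (F x)%:E = \int[mu]_(x in `[0%R, +oo[) (F x)%:E +
     \int[mu]_(x in `[0%R, +oo[) (F (- x))%:E)%E.
  move=> cF F0.
  have mF : measurable_fun [set: R] F by exact: continuous_measurable_fun.
  have mpos : measurable (`[0%R, +oo[%classic : set R) by [].
  rewrite -(setUv `[0%R, +oo[%classic) ge0_integral_setU//=; last 4 first.
  - exact: measurableC.
  - by rewrite setUv; exact/measurable_EFinP.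
  - by move=> x _; rewrite lee_fin.
  - exact/disj_setPCl.
  congr +%E; rewrite setCitvr.
  rewrite integral_itv_bndo_bndc; last exact/measurable_EFinP/measurable_funTS.
  rewrite -{1}oppr0 ge0_integration_by_substitutionNy//.
  exact: continuous_subspaceT.
move=> cG G0.
have cGN : continuous (G \o -%R).
  by move=> x; apply: continuous_comp; [exact: opp_continuous|exact: cG].
have G0N x : 0 <= (G \o -%R) x by exact: G0.
rewrite half// (half (G \o -%R))// addeC; congr +%E.
by apply: eq_integral => x _ /=; rewrite opprK.
Qed.

(** The positive and the negative part have the same integral: the centered
    normal distribution has mean zero. *)
Lemma normal_pos_part_eq (s : R) : 0 < s ->
  (\int[normal_prob 0 s]_x (Num.max x 0)%:E =
   \int[normal_prob 0 s]_x (Num.max (- x) 0)%:E)%E.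
Proof.
move=> s0; have sN0 : s != 0 by rewrite gt_eqF.
have cmax : continuous (fun x : R => Num.max x 0).
  by move=> x; apply: (@continuous_max R^o); [exact: cvg_id|exact: cvg_cst].
have cpdf : continuous (normal_pdf 0 s : R -> R) by exact: continuous_normal_pdf.
have mmax : measurable_fun [set: R] (fun x : R => Num.max x 0).
  exact: continuous_measurable_fun.
rewrite !ge0_integral_normal_prob.
- under eq_integral do rewrite -EFinM.
  rewrite (@ge0_integral_opp (fun x => Num.max x 0 * normal_pdf 0 s x)).
  + apply: eq_integral => x _; rewrite -EFinM; congr (_ * _)%:E.
    by rewrite !normal_pdfE// /normal_fun !subr0 sqrrN.
  + by move=> x; apply: cvgM; [exact: cmax|exact: cpdf].
  + by move=> x; rewrite mulr_ge0 ?normal_pdf_ge0// le_max lexx orbT.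
- by move=> x; rewrite lee_fin le_max lexx orbT.
- apply/measurable_EFinP; apply: (measurableT_comp mmax); exact: measurable_funN.
- by move=> x; rewrite lee_fin le_max lexx orbT.
- exact/measurable_EFinP.
Qed.

End normal_moments.

(** * Second moments of weighted sums of independent errors *)

Section independent_pair.
Variables (R : realType) (d : measure_display) (Omega : measurableType d).
Variables (P : probability Omega R) (X Y : {RV P >-> R}).

(** For a pair satisfying the product rule, the joint law is the product law,
    so Fubini applies to the expectation of the product. *)
Lemma expectation_prod_eq0 :
  (forall U V : set R, measurable U -> measurable V ->
     P (X @^-1` U `&` Y @^-1` V) = (P (X @^-1` U) * P (Y @^-1` V))%E) ->
  P.-integrable [set: Omega] (fun w => (X w * Y w)%:E) ->
  P.-integrable [set: Omega] (fun w => (Y w)%:E) ->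
  (\int[P]_w (Y w)%:E = 0)%E ->
  (\int[P]_w (X w * Y w)%:E = 0)%E.
Proof.
move=> prod_rule iXY iY Y0.
pose pair_fun (w : Omega) : (R * R)%type := (X w, Y w).
have mpair : measurable_fun [set: Omega] pair_fun.
  by apply: measurable_fun_pair; exact: measurable_funPT.
pose Z : {mfun Omega >-> (R * R)%type} :=
  HB.pack pair_fun (isMeasurableFun.Build _ _ _ _ pair_fun mpair).
pose f := fun z : R * R => (z.1 * z.2)%:E.
have mf : measurable_fun setT f by apply/measurable_EFinP; exact: measurable_funM.
have lawE A : measurable A ->
    (distribution P X \x distribution P Y)%E A = pushforward P pair_fun A.
  by move=> mA; apply: (product_measure_unique (m' := distribution P Z)).
have iZ : (distribution P X \x distribution P Y)%E.-integrable setT f.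
  apply/integrableP; split=> //.
  rewrite (@eq_measure_integral _ _ _ setT (pushforward P pair_fun)).
    rewrite ge0_integral_pushforward//; last by apply: measurableT_comp.
    by case/integrableP: iXY.
  by move=> ? ? _; exact: lawE.
transitivity (\int[distribution P X \x distribution P Y]_z f z)%E.
  rewrite [RHS](@eq_measure_integral _ _ _ setT (pushforward P pair_fun)).
    by rewrite integral_pushforward.
  by move=> ? ? _; exact: lawE.
rewrite -integral12_prod_meas1//=.
transitivity (\int[distribution P X]_x (0 : \bar R))%E; last by rewrite integral0.
apply: eq_integral => x _; rewrite /fubini_F /f/=.
under eq_integral do rewrite EFinM.
have iYd : (distribution P Y).-integrable [set: R] (EFin : R -> \bar R).
  exact: integrable_pushforward.
by rewrite integralZl//= integral_pushforward//= Y0 mule0.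
Qed.

End independent_pair.

Section noise.
Variables (R : realType) (d : measure_display) (Omega : measurableType d).
Variables (P : probability Omega R) (eps : nat -> {RV P >-> R}) (s : R).
Hypotheses (s0 : 0 < s) (hindep : mutually_independent eps).
Hypothesis hnormal : forall i (U : set R), measurable U ->
  distribution P (eps i) U = normal_prob 0 s U.

(** The common second moment of the errors. *)
Definition noise_moment : R := fine (\int[normal_prob 0 s]_x (x ^+ 2)%:E)%E.

Let ge0_integral_eps i (f : R -> \bar R) : measurable_fun [set: R] f ->
  (forall x, (0 <= f x)%E) ->
  (\int[P]_w f (eps i w) = \int[normal_prob 0 s]_x f x)%E.
Proof.
move=> mf f0.
(* The law of the error and the normal distribution are measures on two copies of
   the real line, with the same measurable sets but different displays; the
   identity map transports one to the other. *)
have mid : measurable_fun [set: measurableTypeR R] (id : measurableTypeR R -> R) by [].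
have mf' : measurable_fun [set: measurableTypeR R] (f : measurableTypeR R -> \bar R).
  exact: mf.
transitivity (\int[distribution P (eps i)]_x f x)%E.
  by rewrite ge0_integral_distribution.
pose idm : {mfun measurableTypeR R >-> R} :=
  HB.pack (id : measurableTypeR R -> R) (isMeasurableFun.Build _ _ _ _ _ mid).
transitivity (\int[distribution (normal_prob 0 s) idm]_x f x)%E.
  by apply: eq_measure_integral => A mA _; exact: hnormal.
by rewrite ge0_integral_distribution.
Qed.

Let meps i : measurable_fun [set: Omega] (eps i).
Proof. exact: measurable_funPT. Qed.

Lemma noise_moment_ge0 : 0 <= noise_moment.
Proof. by rewrite fine_ge0// integral_ge0// => x _; rewrite lee_fin sqr_ge0. Qed.

Lemma integral_eps_sq i : (\int[P]_w (eps i w ^+ 2)%:E = noise_moment%:E)%E.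
Proof.
rewrite (@ge0_integral_eps i (fun x => (x ^+ 2)%:E)).
- rewrite /noise_moment fineK// ge0_fin_numE ?normal_second_moment//.
  by rewrite integral_ge0// => x _; rewrite lee_fin sqr_ge0.
- by apply/measurable_EFinP; exact: measurable_funX.
- by move=> x; rewrite lee_fin sqr_ge0.
Qed.

Let integrable_eps_sq i :
  P.-integrable [set: Omega] (fun w => (eps i w ^+ 2)%:E).
Proof.
apply/integrableP; split; first by apply/measurable_EFinP; exact: measurable_funX.
under eq_integral do rewrite gee0_abs ?lee_fin ?sqr_ge0//.
by rewrite integral_eps_sq ltry.
Qed.

Let integrable_eps_prod i j :
  P.-integrable [set: Omega] (fun w => (eps i w * eps j w)%:E).
Proof.
apply: (le_integrable measurableT _ _ (integrableD measurableT
  (integrable_eps_sq i) (integrable_eps_sq j))).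
  by apply/measurable_EFinP; exact: measurable_funM.
move=> w _; rewrite -EFinD !abse_EFin lee_fin.
rewrite [leRHS]ger0_norm ?addr_ge0 ?sqr_ge0// ler_norml; apply/andP.
have := sqr_ge0 (eps i w - eps j w); have := sqr_ge0 (eps i w + eps j w).
by have := sqr_ge0 (eps i w); have := sqr_ge0 (eps j w); split; nra.
Qed.

Let integrable_eps i : P.-integrable [set: Omega] (fun w => (eps i w)%:E).
Proof.
have i1 : P.-integrable [set: Omega] (fun=> 1%:E : \bar R).
  by apply: finite_measure_integrable_cst.
apply: (le_integrable measurableT _ _ (integrableD measurableT
  (integrable_eps_sq i) i1)); first exact/measurable_EFinP.
move=> w _; rewrite -EFinD !abse_EFin lee_fin.
rewrite [leRHS]ger0_norm ?addr_ge0 ?sqr_ge0// ler_norml; apply/andP.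
have := sqr_ge0 (eps i w - 1); have := sqr_ge0 (eps i w + 1).
by have := sqr_ge0 (eps i w); split; nra.
Qed.

Let integral_eps i : (\int[P]_w (eps i w)%:E = 0)%E.
Proof.
have posE : (\int[P]_w ((fun w => (eps i w)%:E)^\+ w) =
    \int[P]_w (Num.max (eps i w) 0)%:E)%E.
  by apply: eq_integral => w _; rewrite funeposE EFin_max.
have negE : (\int[P]_w ((fun w => (eps i w)%:E)^\- w) =
    \int[P]_w (Num.max (- eps i w) 0)%:E)%E.
  by apply: eq_integral => w _; rewrite funenegE EFin_max EFinN.
have fin : (\int[P]_w (Num.max (- eps i w) 0)%:E)%E \is a fin_num.
  by rewrite -negE; exact/integrable_fin_num/integrable_funeneg.
have mmax : measurable_fun [set: R] (fun x : R => Num.max x 0).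
  by apply: measurable_maxr => //.
have max0 (x : R) : (0 <= (Num.max x 0)%:E)%E by rewrite lee_fin le_max lexx orbT.
have mmaxN : measurable_fun [set: R] (fun x : R => (Num.max (- x) 0)%:E).
  by apply/measurable_EFinP; apply: (measurableT_comp mmax); exact: measurable_funN.
rewrite integralE posE negE.
rewrite (@ge0_integral_eps i (fun x => (Num.max x 0)%:E))//; last exact/measurable_EFinP.
rewrite normal_pos_part_eq//.
rewrite -(@ge0_integral_eps i (fun x => (Num.max (- x) 0)%:E))//.
by rewrite subee.
Qed.

Let integral_eps_prod i j : (\int[P]_w (eps i w * eps j w)%:E =
  (if i == j then noise_moment else 0)%:E)%E.
Proof.
case: eqVneq => [->|ij].
  by rewrite -(integral_eps_sq j); apply: eq_integral => w _; rewrite expr2.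
apply: expectation_prod_eq0 => // U V mU mV.
have := hindep (s := [:: i; j]) (U := fun k => if k == i then U else V).
rewrite /= inE ij/= => /(_ isT).
have mUV k : measurable (if k == i then U else V) by case: ifP.
move=> /(_ mUV); rewrite big_cons big_seq1 eqxx eq_sym (negbTE ij) => <-.
congr (P _); apply/seteqP; split=> w /=.
  move=> [wU wV] k; rewrite !inE => /orP[/eqP ->|/eqP ->]; first by rewrite eqxx.
  by rewrite eq_sym (negbTE ij).
move=> h; split.
  by have := h i; rewrite inE eqxx/= => /(_ isT).
by have := h j; rewrite !inE eqxx orbT eq_sym (negbTE ij) => /(_ isT).
Qed.

(** The vector of the first [n] errors. *)
Definition noise_vec n w : 'cV[R]_n := \col_(i < n) eps i w.

Lemma noise_dotvE n (a : 'cV[R]_n) w :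
  dotv a (noise_vec n w) = \sum_(i < n) a i 0 * eps i w.
Proof. by apply: eq_bigr => i _; rewrite mxE. Qed.

Lemma measurable_noise_dotv n (a : 'cV[R]_n) :
  measurable_fun [set: Omega] (fun w => dotv a (noise_vec n w)).
Proof.
under eq_fun do rewrite noise_dotvE.
by apply: measurable_sum => i; exact: measurable_funM.
Qed.

(** The errors are pairwise uncorrelated, so only the diagonal terms remain. *)
Lemma integral_noise_dotv_sq n (a : 'cV[R]_n) :
  (\int[P]_w (dotv a (noise_vec n w) ^+ 2)%:E =
   (noise_moment * norm2 a ^+ 2)%:E)%E.
Proof.
have e w : (dotv a (noise_vec n w) ^+ 2)%:E =
    (\sum_(i < n) \sum_(j < n) (a i 0 * a j 0)%:E * (eps i w * eps j w)%:E)%E.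
  rewrite noise_dotvE expr2 mulr_suml -sumEFin; apply: eq_bigr => i _.
  rewrite mulr_sumr -sumEFin; apply: eq_bigr => j _.
  by rewrite -EFinM mulrACA.
have iij i j : P.-integrable [set: Omega]
    (fun w => (a i 0 * a j 0)%:E * (eps i w * eps j w)%:E)%E.
  exact: integrableZl.
under eq_integral do rewrite e.
rewrite integral_sum//=; last by move=> i; exact: integrable_sum.
have -> : (noise_moment * norm2 a ^+ 2)%:E =
    (\sum_(i < n) (noise_moment * a i 0 ^+ 2)%:E)%E.
  by rewrite sumEFin norm2_sq mulr_sumr.
apply: eq_bigr => i _; rewrite integral_sum//=.
rewrite (bigD1 i)//= big1 ?adde0 => [|j ji].
  rewrite integralZl//= integral_eps_prod eqxx -EFinM; congr (_%:E); ring.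
rewrite integralZl//= integral_eps_prod.
by rewrite (_ : (_ == _) = false) ?mule0//; apply/negbTE; rewrite eq_sym.
Qed.

(** Markov's inequality for the sum of the squared correlations of the noise
    with finitely many unit vectors. *)
Lemma noise_event n p (W : 'M[R]_(n, p)) (x : R) : 0 < x ->
  (forall j, norm2 (col j W) = 1) ->
  exists F : set Omega, [/\ measurable F,
    forall w, F w -> forall j, `|dotv (col j W) (noise_vec n w)| <= x &
    ((1 - p%:R * noise_moment / x ^+ 2)%:E <= P F)%E].
Proof.
move=> x0 W1.
pose Q w := \sum_(j < p) dotv (col j W) (noise_vec n w) ^+ 2.
have mQ : measurable_fun [set: Omega] Q.
  by apply: measurable_sum => j; apply: measurable_funX; exact: measurable_noise_dotv.
have intQ : (\int[P]_w (Q w)%:E = (p%:R * noise_moment)%:E)%E.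
  under eq_integral do rewrite /Q -sumEFin.
  rewrite ge0_integral_sum//=; last 2 first.
  - move=> j; apply/measurable_EFinP; apply: measurable_funX.
    exact: measurable_noise_dotv.
  - by move=> j w _; rewrite lee_fin sqr_ge0.
  under eq_bigr do rewrite integral_noise_dotv_sq W1 expr1n mulr1.
  by rewrite sumEFin sumr_const card_ord mulr_natl.
pose G := [set w | x ^+ 2 <= Q w].
have mG : measurable G.
  rewrite [X in measurable X](_ : _ = [set: Omega] `&` Q @^-1` `[x ^+ 2, +oo[); last first.
    by apply/seteqP; split=> w /=; rewrite in_itv/= andbT => // -[].
  exact: mQ.
exists (~` G); split.
- exact: measurableC.
- move=> w /negP; rewrite -ltNge => Qx j.
  rewrite -(ler_pXn2r (ltn0Sn 1)) ?nnegrE ?(ltW x0)//.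
  rewrite real_normK ?num_real//; apply: le_trans (ltW Qx).
  by rewrite /Q (bigD1 j)//= lerDl sumr_ge0// => k _; exact: sqr_ge0.
rewrite probability_setC// EFinB leeB// .
have x20 : 0 < x ^+ 2 by rewrite exprn_gt0.
have : ((x ^+ 2)%:E * P G <= (p%:R * noise_moment)%:E)%E.
  rewrite -intQ -integral_cst//.
  apply: (@le_trans _ _ (\int[P]_(w in G) (Q w)%:E)%E).
    apply: ge0_le_integral => //.
    - by move=> w _; rewrite lee_fin ltW.
    - by apply/measurable_EFinP; exact: measurable_funTS.
  apply: ge0_subset_integral => //.
  - exact/measurable_EFinP.
  - by move=> w _; rewrite lee_fin sumr_ge0// => j _; exact: sqr_ge0.
by rewrite muleC -lee_pdivlMr// -EFinM.
Qed.

End noise.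

(** * The functional linear model *)

Section integrals01.
Variable R : realType.

Lemma integrable01_sum (k : nat) (f : 'I_k -> R -> R) (c : 'I_k -> R) :
  (forall j, integrable01 (f j)) ->
  integrable01 (fun t => \sum_(j < k) f j t * c j).
Proof.
move=> fi; rewrite /integrable01.
have h : (@lebesgue_measure R).-integrable `[0%R, 1%R]
    (fun t => \sum_(j < k) ((f j t)%:E * (c j)%:E))%E.
  by apply: integrable_sum => //= j _; apply: integrableZr => //; exact: fi.
apply: eq_integrable h => // t _ /=.
by rewrite -sumEFin; apply: eq_bigr => j _; rewrite EFinM.
Qed.

Lemma int01_sum (k : nat) (f : 'I_k -> R -> R) (c : 'I_k -> R) :
  (forall j, integrable01 (f j)) ->
  int01 (fun t => \sum_(j < k) f j t * c j) = \sum_(j < k) int01 (f j) * c j.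
Proof.
move=> fi; rewrite /int01 /Rintegral.
have fiE j : (\int[lebesgue_measure]_(t in `[0%R, 1%R]) (f j t)%:E)%E =
    (fine (\int[lebesgue_measure]_(t in `[0%R, 1%R]) (f j t)%:E))%:E.
  by rewrite fineK//; apply: integrable_fin_num => //; exact: fi.
have -> : (\int[lebesgue_measure]_(t in `[0%R, 1%R]) (\sum_(j < k) f j t * c j)%:E =
    \int[lebesgue_measure]_(t in `[0%R, 1%R]) \sum_(j < k) (f j t)%:E * (c j)%:E)%E.
  by apply: eq_integral => t _; rewrite -sumEFin; apply: eq_bigr => j _; rewrite EFinM.
have fci j : (@lebesgue_measure R).-integrable `[0%R, 1%R]
    (fun t => (f j t)%:E * (c j)%:E)%E.
  by apply: integrableZr => //; exact: fi.
rewrite integral_sum//.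
rewrite -[RHS]/(fine (\sum_(j < k) _)%:E) -sumEFin; congr fine.
apply: eq_bigr => j _; rewrite integralZr//; last exact: fi.
by rewrite EFinM fiE.
Qed.

Lemma integrable01B (f g : R -> R) : integrable01 f -> integrable01 g ->
  integrable01 (fun t => f t - g t).
Proof.
move=> fi gi; have h : (@lebesgue_measure R).-integrable `[0%R, 1%R]
    (fun t => (f t)%:E - (g t)%:E)%E by exact: integrableB.
by apply: eq_integrable h.
Qed.

Lemma int01B (f g : R -> R) : integrable01 f -> integrable01 g ->
  int01 (fun t => f t - g t) = int01 f - int01 g.
Proof. by move=> fi gi; rewrite /int01 RintegralB. Qed.

Lemma int01_mul_bound (f e : R -> R) (b : R) : 0 <= b ->
  integrable01 f -> integrable01 (fun t => f t * e t) ->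
  (forall t, 0 <= t <= 1 -> `|e t| <= b) ->
  `|int01 (fun t => f t * e t)| <= b * int01 (fun t => `|f t|).
Proof.
move=> b0 fi fei eb.
have nfi : integrable01 (fun t => `|f t|) by exact: integrable_norm.
apply: le_trans (le_normr_Rintegral _ fei) _ => //.
rewrite /int01 -RintegralZl//; apply: le_Rintegral => //.
- exact: (integrable_norm fei).
- have h : (@lebesgue_measure R).-integrable `[0%R, 1%R]
      (fun t => b%:E * (`|f t|)%:E)%E.
    by apply: integrableZl => //; exact: nfi.
  by apply: eq_integrable h.
move=> t; rewrite /= in_itv/= => t01.
by rewrite normrM mulrC ler_wpM2r// eb.
Qed.

End integrals01.

Section standardization.
Variables (R : realType) (n p : nat) (V : 'M[R]_(n, p)).
Hypothesis V0 : forall j, col j V != 0.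

(** The coefficients in the standardized design that correspond to the
    coefficients [g] in the design [V]. *)
Definition rescale (g : 'cV[R]_p) : 'cV[R]_p :=
  \col_j (g j 0 * norm2 (col j V)).

Let normV j : 0 < norm2 (col j V). Proof. exact: norm2_gt0. Qed.

Lemma norm2_standardize j : norm2 (col j (standardize V)) = 1.
Proof.
have h : norm2 (col j (standardize V)) ^+ 2 = 1.
  rewrite norm2_sq; under eq_bigr do rewrite !mxE exprMn.
  rewrite -mulr_suml; have := norm2_sq (col j V).
  under [X in _ = X -> _]eq_bigr do rewrite mxE.
  by move=> <-; rewrite -exprMn divff ?expr1n// gt_eqF.
by apply/eqP; rewrite -(eqrXn2 (ltn0Sn 1) (norm2_ge0 _) ler01) h expr1n.
Qed.

Lemma standardize_rescale g : standardize V *m rescale g = V *m g.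
Proof.
apply/colP => i; rewrite !mxE; apply: eq_bigr => j _; rewrite !mxE.
by field; rewrite gt_eqF.
Qed.

Lemma card_supp_rescale g : (#|supp (rescale g)| <= #|supp g|)%N.
Proof.
apply: subset_leq_card; apply/fintype.subsetP => j; rewrite /supp !inE mxE.
by rewrite mulf_eq0 negb_or => /andP[].
Qed.

Lemma unstandardizeB g h : unstandardize V h - g = unstandardize V (h - rescale g).
Proof. by apply/colP => j; rewrite !mxE; field; rewrite gt_eqF. Qed.

End standardization.

Section model.
Variables (R : realType) (X : nat -> R -> R) (beta : R -> R) (n p : nat).
Variables (B : R -> 'cV[R]_p) (A : 'M[R]_p) (eta : 'cV[R]_p) (M om : R).
Hypotheses (n0 : (0 < n)%N) (unitA : A \in unitmx).
Hypothesis hintX : forall i, integrable01 (X i).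
Hypothesis hintXbeta : forall i, integrable01 (fun s => X i s * beta s).
Hypothesis hintXB : forall i (j : 'I_p), integrable01 (fun s => X i s * B s j 0).
Hypothesis hM : forall i, int01 (fun s => `|X i s|) <= M.
Hypotheses (om0 : 0 <= om).
Hypothesis hom : forall s, 0 <= s <= 1 -> `|approx_err beta B eta s| <= om.
Local Notation V := (Vmat X n B A).
Local Notation W := (standardize V).
Hypothesis V0 : forall j, col j V != 0.
Local Notation truth := (rescale V (A *m eta)).

Lemma VmatE (i : 'I_n) j : V i j = int01 (fun s => X i s * basis_Ainv B A j s).
Proof.
rewrite mxE; under eq_bigr do rewrite mxE.
rewrite -int01_sum//; congr int01; apply/funext => s.
rewrite /basis_Ainv mxE mulr_sumr; apply: eq_bigr => k _.
by rewrite !mxE mulrA.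
Qed.

(** [alpha] is [sqrt n] times the norm of the linear functional that maps the
    standardized coefficients to the value of the estimate at [s]. *)
Lemma alphaE s : alpha X n B A s = Num.sqrt n%:R *
  Num.sqrt (\sum_(j < p) (basis_Ainv B A j s / norm2 (col j V)) ^+ 2).
Proof.
rewrite -sqrtrM// mulr_sumr; congr Num.sqrt; apply: eq_bigr => j _.
rewrite expr_div_n norm2_sq.
have -> : \sum_(i < n) (col j V) i 0 ^+ 2 =
    \sum_(i < n) int01 (fun t => X i t * basis_Ainv B A j t) ^+ 2.
  by apply: eq_bigr => i _; rewrite [col _ _ _ _]mxE VmatE.
set D := \sum_(i < n) _; rewrite invfM invrK; ring.
Qed.

Lemma alpha_ge0 s : 0 <= alpha X n B A s.
Proof. exact: sqrtr_ge0. Qed.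

(** The part of the response that the finite-dimensional model does not
    explain, apart from the noise. *)
Definition model_bias : 'cV[R]_n :=
  \col_(i < n) (int01 (fun s => X i s * beta s) - (scores X n B *m eta) i 0).

Let model_biasE i :
  model_bias i 0 = int01 (fun s => X i s * approx_err beta B eta s) /\
  integrable01 (fun s => X i s * approx_err beta B eta s).
Proof.
have fE : (fun s => X i s * approx_err beta B eta s) =
    (fun s => X i s * beta s - \sum_(k < p) X i s * B s k 0 * eta k 0).
  apply/funext => s; rewrite /approx_err mulrBr mxE mulr_sumr; congr (_ - _).
  by apply: eq_bigr => k _; rewrite mxE mulrA.
have hs : integrable01 (fun s => \sum_(k < p) X i s * B s k 0 * eta k 0).
  by apply: (integrable01_sum (f := fun k s => X i s * B s k 0)).
rewrite fE; split; last exact: integrable01B.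
rewrite int01B// mxE (int01_sum (f := fun k s => X i s * B s k 0))//.
by congr (_ - _); rewrite mxE; apply: eq_bigr => k _; rewrite mxE.
Qed.

Let M0 : 0 <= M.
Proof. by apply: le_trans (hM 0); apply: Rintegral_ge0 => s _; exact: normr_ge0. Qed.

Lemma model_bias_le : norm2 model_bias <= M * om * Num.sqrt n%:R.
Proof.
rewrite -(ler_pXn2r (ltn0Sn 1)) ?nnegrE ?mulr_ge0 ?sqrtr_ge0 ?norm2_ge0//.
rewrite exprMn (sqr_sqrtr (ler0n _ n)) norm2_sq.
apply: (@le_trans _ _ (\sum_(i < n) (M * om) ^+ 2)); last first.
  by rewrite sumr_const card_ord mulr_natr.
apply: ler_sum => i _; have [-> fi] := model_biasE i.
rewrite -real_normK ?num_real// ler_pXn2r ?nnegrE ?mulr_ge0//.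
apply: le_trans (int01_mul_bound om0 (hintX i) fi hom) _.
by rewrite mulrC ler_wpM2r.
Qed.

Lemma response_residual (e : nat -> R) :
  responses X beta n e - W *m truth = (\col_(i < n) e i) + model_bias.
Proof.
rewrite standardize_rescale// /Vmat mulmxA mulmxKV//.
by apply/colP => i; rewrite !mxE; ring.
Qed.

(** Up to the bias, the residual at the true coefficients is the noise. *)
Lemma response_correlation (e : nat -> R) j :
  `|dotv (col j W) (responses X beta n e - W *m truth) -
    dotv (col j W) (\col_(i < n) e i)| <= M * om * Num.sqrt n%:R.
Proof.
rewrite response_residual dotvDr addrAC subrr add0r.
apply: le_trans (dotv_le _ _) _.
by rewrite norm2_standardize// mul1r model_bias_le.
Qed.

Lemma estimation_error (g : 'cV[R]_p) s : 0 <= s <= 1 ->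
  `|beta_hat B A V g s - beta s| <=
    alpha X n B A s / Num.sqrt n%:R * norm2 (g - truth) + om.
Proof.
move=> s01.
have -> : beta_hat B A V g s - beta s =
    ((B s)^T *m invmx A *m unstandardize V (g - truth)) 0 0 -
    approx_err beta B eta s.
  rewrite -unstandardizeB// mulmxBr [in RHS]mulmxA mulmxKV// /beta_hat /approx_err.
  by rewrite [in RHS]mxE [X in _ + X - _]mxE; ring.
apply: le_trans (ler_normB _ _) _; apply: lerD; last exact: hom.
set h := g - truth.
pose c : 'cV[R]_p := \col_j (basis_Ainv B A j s / norm2 (col j V)).
have -> : ((B s)^T *m invmx A *m unstandardize V h) 0 0 = dotv c h.
  rewrite mxE; apply: eq_bigr => j _; rewrite [c _ _]mxE [unstandardize _ _ _ _]mxE.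
  have -> : basis_Ainv B A j s = ((B s)^T *m invmx A) 0 j.
    by rewrite /basis_Ainv !mxE; apply: eq_bigr => k _; rewrite !mxE.
  ring.
have sn0 : 0 < Num.sqrt n%:R :> R by rewrite sqrtr_gt0 ltr0n.
rewrite alphaE [_ * Num.sqrt _]mulrC mulfK ?gt_eqF//.
apply: le_trans (dotv_le c h) _; rewrite ler_wpM2r ?norm2_ge0//.
by rewrite /norm2 ler_wsqrtr// ler_sum// => j _; rewrite mxE.
Qed.

End model.

(** * Consistency of the estimate *)

(** For a single regressor the tuning parameter vanishes up to the bias, so the
    noise is absorbed into the target: the least squares coefficient computed
    without bias is feasible. *)
Lemma one_regressor_error (R : realType) (n p : nat) (Z : 'M[R]_(n, p))
    (y : 'cV[R]_n) (lambda : R) (g gamma : 'cV[R]_p) (S : nat) (N : R) (j0 : 'I_p) :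
  p = 1%N -> 0 <= lambda ->
  is_dantzig (standardize Z) y lambda g ->
  norm2 (col j0 (standardize Z)) = 1 ->
  (#|supp gamma| <= S)%N ->
  `|dotv (col j0 (standardize Z)) (y - standardize Z *m gamma) - N| <= lambda ->
  restricted_isometry Z (2 * S) + restricted_orthogonality Z S (2 * S) < 1 ->
  norm2 (g - gamma) <= 4 * lambda * Num.sqrt S%:R /
    (1 - restricted_isometry Z (2 * S) - restricted_orthogonality Z S (2 * S))
    + `|N|.
Proof.
move=> p1; subst p; rewrite (ord1 j0) => l0 gD W1 gS hN dt1.
set W := standardize Z in gD W1 hN *.
have norm_ord1 (x : 'cV[R]_1) : norm2 x = `|x 0 0|.
  by rewrite /norm2 big_ord1 sqrtr_sqr.
have mulW (x : 'cV[R]_1) : W *m x = x 0 0 *: col 0 W.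
  by apply/colP => i; rewrite mxE big_ord1 [RHS]mxE [X in _ = _ * X]mxE mulrC.
pose gamma' : 'cV[R]_1 := gamma + const_mx N.
have feas : dantzig_feasible W y lambda gamma'.
  move=> j; rewrite (ord1 j) mul_tr_dotv.
  rewrite mulmxDr [W *m const_mx N]mulW mxE opprD addrA dotvBr dotvZr.
  by rewrite -norm2_dotv W1 expr1n mulr1.
have [S0|S0] := posnP S.
  rewrite S0 sqrtr0 mulr0 mul0r add0r.
  have g00 j : gamma j 0 = 0.
    apply: notin_supp; move: gS; rewrite S0 leqn0 cards_eq0 => /eqP ->.
    by rewrite finset.in_set0.
  have -> : gamma = 0 by apply/colP => j; rewrite g00 mxE.
  rewrite subr0 norm_ord1; have := gD.2 _ feas.
  by rewrite /norm1 !big_ord1 mxE g00 add0r mxE.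
have gS' : (#|supp gamma'| <= S)%N.
  by apply: leq_trans S0; apply: leq_trans (max_card _) _; rewrite card_ord.
have := dantzig_error l0 gD feas gS' dt1.
rewrite !norm_ord1 => h; apply: le_trans (lerD h (lexx _)).
have -> : (g - gamma) 0 0 = (g - gamma') 0 0 + N by rewrite !mxE; ring.
exact: ler_normD.
Qed.

(** Substituting the tuning parameter splits the error bound into a parametric
    term and an approximation term. *)
Lemma error_split (R : realType) (a Ka q L M om Hp D kappa r r' x : R) :
  0 <= a -> a <= Ka -> 0 < q -> 0 <= L -> 0 <= M -> 0 <= om -> om <= Hp ->
  0 < kappa -> kappa <= D -> 0 <= r -> r <= r' -> 0 <= x ->
  a / q * (4 * (L + M * om * q) * r / D + x) + om <=
  (4 * Ka * L * r' / kappa + Ka * x) * q^-1 + Hp * (1 + 4 * a / D * M * r').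
Proof.
move=> a0 aK q0 L0 M0 om0 omH k0 kD r0 rr' x0.
have D0 : 0 < D by exact: lt_le_trans kD.
have K0 : 0 <= Ka by exact: le_trans aK.
have qi0 : 0 <= q^-1 by rewrite invr_ge0 ltW.
have u0 : 0 <= a / D by rewrite divr_ge0// ltW.
have uK : a / D <= Ka / kappa.
  by rewrite ler_pM// ?invr_ge0 ?(ltW D0)// lef_pV2 ?posrE.
rewrite [leLHS](_ : _ = 4 * L * ((a / D) * r) * q^-1 + a * x * q^-1 +
  (4 * M * (a / D)) * (om * r) + om); last by field; rewrite !gt_eqF.
rewrite [leRHS](_ : _ = 4 * L * ((Ka / kappa) * r') * q^-1 + Ka * x * q^-1 +
  (4 * M * (a / D)) * (Hp * r') + Hp); last by field; rewrite !gt_eqF.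
apply: lerD => //; apply: lerD; [apply: lerD|].
- by apply: ler_wpM2r => //; apply: ler_wpM2l; [exact: mulr_ge0|exact: ler_pM].
- by apply: ler_wpM2r => //; apply: ler_wpM2r.
- apply: ler_wpM2l; last exact: ler_pM.
  by apply: mulr_ge0 => //; exact: mulr_ge0.
Qed.

Lemma sup01_ge (R : realType) (f : R -> R) s : 0 <= s <= 1 ->
  ((f s)%:E <= sup01 f)%E.
Proof. by move=> s01; apply: ereal_sup_ubound; exists s => //=; rewrite in_itv. Qed.

Lemma sup01_le (R : realType) (f : R -> R) (b : \bar R) :
  (forall s, 0 <= s <= 1 -> ((f s)%:E <= b)%E) -> (sup01 f <= b)%E.
Proof.
move=> h; apply: ge_ereal_sup => _ [s s01 <-]; apply: h.
by move: s01; rewrite /= in_itv.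
Qed.

Lemma powRN12 (R : realType) (n : nat) : (n%:R : R) `^ (- 2^-1) = (Num.sqrt n%:R)^-1.
Proof. by rewrite powRN powR12_sqrt. Qed.

Theorem theorem3 (R : realType) (d : measure_display)
  (Omega : measurableType d) (P : probability Omega R)
  (X : nat -> R -> R) (beta : R -> R)
  (B : forall p : nat, R -> 'cV[R]_p) (A : forall p : nat, 'M[R]_p)
  (eta : forall p : nat, 'cV[R]_p) (Sp : nat -> nat)
  (eps : nat -> {RV P >-> R}) (sigma1 M : R)
  (S : nat) (m H : R) (t : R) (pstar : nat)
  (meth : flirti_method)
  (ghat : R -> nat -> Omega -> 'cV[R]_pstar)
  (hbasis : forall p, (0 < p)%N -> lin_indep01 (B p))
  (hintX : forall i, integrable01 (X i))
  (hintXbeta : forall i, integrable01 (fun s => X i s * beta s))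
  (hintXB : forall p i (j : 'I_p), integrable01 (fun s => X i s * B p s j 0))
  (hA : forall p, (0 < p)%N -> A p \in unitmx)
  (hSp : forall p, (0 < p)%N -> (#|supp (A p *m eta p)| <= Sp p)%N)
  (hV : forall n p (j : 'I_p), (0 < n)%N ->
     col j (Vmat X n (B p) (A p)) != 0)
  (hsigma1 : 0 < sigma1)
  (hindep : mutually_independent eps)
  (hnormal : forall i (U : set R), measurable U ->
     distribution P (eps i) U = normal_prob 0 sigma1 U)
  (hM : forall i, int01 (fun s => `|X i s|) <= M)
  (hA1 : forall p, (0 < p)%N -> (Sp p <= S)%N)
  (hm : 0 < m)
  (hA2 : forall p, (0 < p)%N ->
     (omega beta (B p) (eta p) <= (H / p%:R `^ m)%:E)%E)
  (ht : 0 <= t <= 1)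
  (hA3 : exists b K : R, forall n p, (0 < n)%N -> (0 < p)%N ->
     p%:R `^ (- b) * alpha X n (B p) (A p) t <= K)
  (hA4 : exists c K : R, forall n p, (0 < n)%N -> (0 < p)%N ->
     ((p%:R `^ (- c))%:E * sup01 (alpha X n (B p) (A p)) <= K%:E)%E)
  (hpstar : (0 < pstar)%N)
  (hA5 : exists2 kappa : R, 0 < kappa & \forall n \near \oo,
     restricted_isometry (Vmat X n (B pstar) (A pstar)) (2 * S)
     + restricted_orthogonality (Vmat X n (B pstar) (A pstar)) S (2 * S)
     <= 1 - kappa)
  (hghat : forall (phi : R) (n : nat) (w : Omega), 0 <= phi -> (0 < n)%N ->
     is_solution meth (standardize (Vmat X n (B pstar) (A pstar)))
       (responses X beta n (fun i => eps i w))
       (tuning sigma1 phi M pstar n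
          (fine (omega beta (B pstar) (eta pstar))))
       (ghat phi n w))
  (hrip : \forall n \near \oo,
     restricted_isometry (Vmat X n (B pstar) (A pstar)) (2 * Sp pstar)
     + restricted_orthogonality (Vmat X n (B pstar) (A pstar))
         (Sp pstar) (2 * Sp pstar) < 1)
  (hlasso : meth = Lasso -> forall phi : R, 0 <= phi ->
     \forall n \near \oo, {ae P, forall w : Omega,
       lasso_condition (standardize (Vmat X n (B pstar) (A pstar)))
         (ghat phi n w)}) :
  forall rho : R, 0 < rho ->
  exists2 phi0 : R, 0 <= phi0 &
  forall phi : R, phi0 <= phi ->
  exists (K : R) (N : nat), forall n : nat, (N <= n)%N ->
  let bhat := fun w : Omega =>
    beta_hat (B pstar) (A pstar) (Vmat X n (B pstar) (A pstar))
      (ghat phi n w) in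
  let En :=
    E_bound X H m M S (Sp pstar) n (B pstar) (A pstar) in
  with_prob_ge P (1 - rho)
    [set w : Omega |
       `|bhat w t - beta t| <= K * n%:R `^ (- 2^-1) + En t /\
       (sup01 (fun s => (`|bhat w s - beta s|)%R)
          <= ((K * n%:R `^ (- 2^-1))%R)%:E + sup01 En)%E].
Proof.
move=> rho rho0.
set p := pstar in hpstar *.
set Bp := B pstar; set Ap := A pstar; set ep := eta pstar.
pose Hp := H / p%:R `^ m.
have pR0 : 0 < p%:R :> R by rewrite ltr0n.
have unitA : Ap \in unitmx by exact: hA.
have M0 : 0 <= M.
  by apply: le_trans (hM 0); apply: Rintegral_ge0 => s _; exact: normr_ge0.
pose om := fine (omega beta Bp ep).
have om_ub : (omega beta Bp ep <= Hp%:E)%E by exact: hA2.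
have om_lb s : 0 <= s <= 1 -> (`|approx_err beta Bp ep s|%:E <= omega beta Bp ep)%E.
  exact: (sup01_ge (fun s => `|approx_err beta Bp ep s|)).
have om_ge0 : (0 <= omega beta Bp ep)%E.
  by apply: le_trans (om_lb t ht); rewrite lee_fin.
have omE : om%:E = omega beta Bp ep.
  by rewrite /om fineK// ge0_fin_numE// (le_lt_trans om_ub)// ltry.
have om0 : 0 <= om by rewrite -lee_fin omE.
have omH : om <= Hp by rewrite -lee_fin omE.
have hom s : 0 <= s <= 1 -> `|approx_err beta Bp ep s| <= om.
  by move=> s01; rewrite -lee_fin omE om_lb.
(* For fixed [p] the growth condition on [alpha] is a uniform bound. *)
have [Ka Ka0 alpha_le] : exists2 Ka : R, 0 <= Ka &
    forall n s, (0 < n)%N -> 0 <= s <= 1 -> alpha X n Bp Ap s <= Ka.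
  have [c [K hK]] := hA4; exists (`|K| / p%:R `^ (- c)).
    by rewrite divr_ge0// powR_ge0.
  move=> n s n0 s01; rewrite ler_pdivlMr ?powR_gt0//.
  apply: le_trans (ler_norm K); rewrite -lee_fin EFinM muleC.
  apply: le_trans (hK n p n0 hpstar); rewrite lee_pmul2l ?lte_fin ?powR_gt0//.
  exact: sup01_ge.
have [kappa kappa0 [N1 _ hN1]] := hA5.
pose D n := 1 - restricted_isometry (Vmat X n Bp Ap) (2 * Sp p)
     - restricted_orthogonality (Vmat X n Bp Ap) (Sp p) (2 * Sp p).
have SpS : (Sp p <= S)%N by exact: hA1.
have kappaD n : (N1 <= n)%N -> kappa <= D n.
  move=> /hN1/=; rewrite /D => h.
  have h1 : restricted_isometry (Vmat X n Bp Ap) (2 * Sp p) <=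
      restricted_isometry (Vmat X n Bp Ap) (2 * S).
    by apply: restricted_isometry_mono; rewrite leq_mul2l SpS orbT.
  have h2 : restricted_orthogonality (Vmat X n Bp Ap) (Sp p) (2 * Sp p) <=
      restricted_orthogonality (Vmat X n Bp Ap) S (2 * S).
    by apply: restricted_orthogonality_mono => //; rewrite leq_mul2l SpS orbT.
  lra.
(* [L] is the noise part of the tuning parameter. *)
pose L phi := sigma1 * Num.sqrt (2 * (1 + phi) * ln p%:R).
have L0 phi : 0 <= L phi by rewrite mulr_ge0 ?sqrtr_ge0// ltW.
pose lam phi n := tuning sigma1 phi M p n om.
have lamE phi n : lam phi n = L phi + M * om * Num.sqrt n%:R by [].
have lam0 phi n : 0 <= lam phi n by rewrite lamE addr_ge0// mulr_ge0 ?sqrtr_ge0// mulr_ge0.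
pose truth n := rescale (Vmat X n Bp Ap) (Ap *m ep).
have truthS n : (0 < n)%N -> (#|supp (truth n)| <= Sp p)%N.
  by move=> n0; apply: leq_trans (card_supp_rescale _ _) (hSp _ hpstar).
(* For large [n], outside of a negligible set, the estimate solves the Dantzig problem. *)
have dantz phi : 0 <= phi -> exists N2, forall n, (N2 <= n)%N -> (0 < n)%N ->
    exists2 Nul, measurable Nul /\ P Nul = 0%E &
    forall w, ~ Nul w -> is_dantzig (standardize (Vmat X n Bp Ap))
      (responses X beta n (fun i => eps i w)) (lam phi n) (ghat phi n w).
  move=> phi0; case: meth hghat hlasso => [hgh hla|hgh _]; last first.
    exists 0%N => n _ n0; exists set0; first by split.
    by move=> w _; exact: hgh.
  have [N2 _ h2] := hla erefl phi phi0; exists N2 => n nN2 n0.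
  have [Nul [mNul Nul0 hNul]] := h2 n nN2; exists Nul; first by split.
  move=> w wNul; apply: lasso_is_dantzig => //; first exact: hgh.
  by apply: contrapT => h; apply: wNul; exact: hNul.
pose v := @noise_moment R sigma1.
have v0 : 0 <= v by exact: noise_moment_ge0.
(* The error of the standardized estimate is at most the bound of the Dantzig
   selector, up to a constant that is needed only for one regressor. *)
have key : exists2 phi0 : R, 0 <= phi0 & forall phi, phi0 <= phi ->
    exists2 x : R, 0 <= x & exists N2, forall n, (N2 <= n)%N -> (0 < n)%N ->
    (N1 <= n)%N ->
    exists F : set Omega, [/\ measurable F, ((1 - rho)%:E <= P F)%E &
      forall w, F w -> norm2 (ghat phi n w - truth n) <=
        4 * lam phi n * Num.sqrt (Sp p)%:R / D n + x].
  (* The event on which the estimate solves the Dantzig problem and all the noise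
     correlations are at most [yy]. *)
  have event phi n yy : 0 <= phi -> 0 < yy -> p%:R * v / yy ^+ 2 <= rho ->
      (0 < n)%N -> (exists2 Nul, measurable Nul /\ P Nul = 0%E &
        forall w, ~ Nul w -> is_dantzig (standardize (Vmat X n Bp Ap))
        (responses X beta n (fun i => eps i w)) (lam phi n) (ghat phi n w)) ->
      exists F : set Omega, [/\ measurable F, ((1 - rho)%:E <= P F)%E,
        forall w, F w -> is_dantzig (standardize (Vmat X n Bp Ap))
          (responses X beta n (fun i => eps i w)) (lam phi n) (ghat phi n w) &
        forall w, F w -> forall j, `|dotv (col j (standardize (Vmat X n Bp Ap)))
          (noise_vec eps n w)| <= yy].
    move=> phi0 yy0 hyy n0 [Nul [mNul Nul0] hNul].
    have [F0 [mF0 hF0 PF0]] := noise_event hsigma1 hindep hnormal yy0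
      (fun j => norm2_standardize (fun k => hV n p k n0) j).
    exists (F0 `\` Nul); split.
    - exact: measurableD.
    - apply: (@le_trans _ _ (P F0)).
        by apply: le_trans PF0; rewrite lee_fin lerD2l lerN2.
      rewrite (measureDI P mF0 mNul) [X in (_ + X)%E](_ : _ = 0%E) ?adde0//.
      by apply/eqP; rewrite -measure_le0 -Nul0 le_measure// ?inE//; exact: measurableI.
    - by move=> w [_ wN]; exact: hNul.
    - by move=> w [F0w _]; exact: hF0.
  have corr n w j : (0 < n)%N ->
      `|dotv (col j (standardize (Vmat X n Bp Ap)))
        (responses X beta n (fun i => eps i w) -
          standardize (Vmat X n Bp Ap) *m truth n) -
        dotv (col j (standardize (Vmat X n Bp Ap))) (noise_vec eps n w)| <=
      M * om * Num.sqrt n%:R.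
    move=> n0; exact: (response_correlation unitA hintX hintXbeta (hintXB p) hM
      om0 hom (fun j => hV n p j n0) (fun i => eps i w) j).
  have rip n : (N1 <= n)%N ->
      restricted_isometry (Vmat X n Bp Ap) (2 * Sp p) +
      restricted_orthogonality (Vmat X n Bp Ap) (Sp p) (2 * Sp p) < 1.
    by move=> /kappaD; rewrite /D; lra.
  have [p1|pN1] := eqVneq p 1%N.
    (* Any [x] with [x ^+ 2 >= v / rho] would do; the [+ 1] makes it positive. *)
    pose x := Num.sqrt (v / rho) + 1.
    have x1 : 0 < x by rewrite ltr_wpDl ?sqrtr_ge0.
    have xv : p%:R * v / x ^+ 2 <= rho.
      rewrite p1 mul1r ler_pdivrMr ?exprn_gt0// mulrC -ler_pdivrMr//.
      rewrite -[leLHS]sqr_sqrtr ?divr_ge0 ?(ltW rho0)//.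
      by rewrite ler_pXn2r ?nnegrE ?sqrtr_ge0 ?(ltW x1)// /x lerDl.
    exists 0 => // phi phi0; exists x; first exact: ltW.
    have [N2 hN2] := dantz phi phi0; exists N2 => n nN2 n0 nN1.
    have [F [mF PF Fd Fn]] := event phi n x phi0 x1 xv n0 (hN2 n nN2 n0).
    exists F; split=> // w Fw.
    apply: le_trans (one_regressor_error (j0 := Ordinal hpstar) p1 (lam0 phi n)
      (Fd w Fw) (norm2_standardize (fun k => hV n p k n0) _) (truthS n n0)
      (le_trans (corr n w _ n0) _) (rip n nN1)) _.
      by rewrite lamE lerDr.
    by rewrite lerD2l Fn.
  have p2 : (1 < p)%N by rewrite ltn_neqAle eq_sym pN1.
  have lnp : 0 < ln p%:R :> R by rewrite ln_gt0// ltr1n.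
  (* The least [phi] for which Markov's bound [p v / L ^+ 2] is below [rho], up to
     replacing [1 + phi] by [phi]. *)
  pose phi0 := p%:R * v / (rho * (sigma1 ^+ 2 * 2 * ln p%:R)).
  have den0 : 0 < rho * (sigma1 ^+ 2 * 2 * ln p%:R).
    by rewrite !mulr_gt0 ?exprn_gt0.
  have phi00 : 0 <= phi0 by rewrite divr_ge0 ?mulr_ge0// ltW.
  exists phi0 => // phi phi_ge; exists 0 => //.
  have phi_ge0 : 0 <= phi by exact: le_trans phi_ge.
  have Lgt0 : 0 < L phi.
    by rewrite mulr_gt0// sqrtr_gt0 mulr_gt0// mulr_gt0// ltr_pwDl.
  have Lrho : p%:R * v / L phi ^+ 2 <= rho.
    rewrite ler_pdivrMr ?exprn_gt0// exprMn sqr_sqrtr; last first.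
      by rewrite mulr_ge0 ?(ltW lnp)// mulr_ge0// addr_ge0.
    have : p%:R * v <= phi * (rho * (sigma1 ^+ 2 * 2 * ln p%:R)).
      by rewrite -ler_pdivrMr.
    move=> /le_trans; apply.
    rewrite [leRHS](_ : _ = (1 + phi) * (rho * (sigma1 ^+ 2 * 2 * ln p%:R))); last by ring.
    by rewrite ler_wpM2r ?(ltW den0)// lerDr.
  have [N2 hN2] := dantz phi phi_ge0; exists N2 => n nN2 n0 nN1.
  have [F [mF PF Fd Fn]] := event phi n (L phi) phi_ge0 Lgt0 Lrho n0 (hN2 n nN2 n0).
  exists F; split=> // w Fw; rewrite addr0.
  apply: (dantzig_error (lam0 phi n) (Fd w Fw) _ (truthS n n0) (rip n nN1)).
  move=> j; rewrite mul_tr_dotv lamE.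
  have h1 := corr n w j n0; have h2 := Fn w Fw j.
  rewrite -[dotv _ (_ - _)](subrK (dotv (col j (standardize (Vmat X n Bp Ap)))
    (noise_vec eps n w))) addrC.
  by apply: le_trans (ler_normD _ _) _; exact: lerD.
have [phi0 phi00 hkey] := key; exists phi0 => // phi phi_ge.
have [x x0 [N2 hN2]] := hkey phi phi_ge.
exists (4 * Ka * L phi * Num.sqrt S%:R / kappa + Ka * x), (maxn 1 (maxn N1 N2)).
set K := 4 * Ka * _ * _ / _ + _.
move=> n; rewrite !geq_max => /and3P[n0 nN1 nN2] bhat En.
have [F [mF PF hF]] := hN2 n nN2 n0 nN1.
exists F; split=> // w Fw.
have pointwise s : 0 <= s <= 1 ->
    `|bhat w s - beta s| <= K * n%:R `^ (- 2^-1) + En s.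
  move=> s01.
  apply: le_trans (estimation_error n0 unitA (hintXB p) hom
    (fun j => hV n p j n0) (ghat phi n w) s01) _.
  have sn0 : 0 < Num.sqrt n%:R :> R by rewrite sqrtr_gt0 ltr0n.
  rewrite powRN12.
  have rSS : Num.sqrt (Sp p)%:R <= Num.sqrt S%:R :> R.
    by rewrite ler_wsqrtr// ler_nat.
  apply: le_trans (error_split (alpha_ge0 _ _ _ _ _) (alpha_le n s n0 s01) sn0
    (L0 phi) M0 om0 omH kappa0 (kappaD n nN1) (sqrtr_ge0 _)
    rSS x0).
  rewrite lerD2r ler_wpM2l//.
  - by rewrite divr_ge0 ?alpha_ge0 ?sqrtr_ge0.
  - exact: hF.
split; first exact: pointwise.
apply: sup01_le => s s01; apply: (@le_trans _ _
  ((K * n%:R `^ (- 2^-1))%:E + (En s)%:E)%E).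
  by rewrite -EFinD lee_fin pointwise.
by rewrite leeD2l// sup01_ge.
Qed.
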